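(* Let $d\ge1$ be an integer and $c\in\mathbb{R}$. Assume that the coupled system with $d$ second class particles is stationary and $\underline{\xi}\sim\underline{\mu}^c$. Then the stationary distribution of $\underline X=(X_1,\dots,X_d)$, the positions of the $d$ second class particles, is given by $$\mathbb{P}(\underline{X}=\underline{m})=\frac{\prod_{i=1}^d(1-q^i)\cdot q^{dc-\sum_{j=1}^dm_j}}{\prod_{j=1}^d(1+q^{c+d-j-m_j})(1+q^{c+d+1-j-m_j})}$$ for all $\underline m=(m_1,\dots,m_d)\in\mathbb{Z}^d$ with $m_1<m_2<\dots<m_d$.
   Context: Fix $q\in(0,1)$. For $c\in\mathbb{R}$, $\underline{\mu}^c$ is the product probability measure on $\{0,1\}^{\mathbb{Z}}$ under which the coordinates $z_i$ are independent with $\underline\mu^c(z_i=1)=\frac{q^{c-i}}{1+q^{c-i}}$. It is concentrated on the countable set $\Omega=\{\underline z\in\{0,1\}^{\mathbb{Z}}:\sum_{i\le0}z_i<\infty,\ \sum_{i\ge1}(1-z_i)<\infty\}$. ASEP: the Markov jump process $\underline\xi(t)$ on $\Omega$ in which, for every $i\in\mathbb{Z}$, a particle at $i$ jumps to $i+1$ at rate $1$ if $i+1$ is empty, and a particle at $i+1$ jumps to $i$ at rate $q$ if $i$ is empty. The label of a particle of $\underline\xi(t)$ is the number of particles of $\underline\xi(t)$ strictly to its left; labels are $0,1,2,\dots$. Coupled system with $d$ second class particles: let $Z_+^d=\{\underline x\in\mathbb{Z}^d:0\le x_1<\dots<x_d\}$. It is the Markov process $(\underline\xi(t),\underline x(t))$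 on $\Omega\times Z_+^d$ in which $\underline\xi(t)$ evolves as ASEP, and the label process $\underline x(t)$ evolves as follows: each coordinate $x_j$ becomes $x_j+1$ at rate $q$ if $x_j+1$ is not one of the coordinates of $\underline x$, and becomes $x_j-1$ at rate $1$ if $x_j-1\ge0$ and $x_j-1$ is not one of the coordinates; in either case the move is allowed only if the two particles of $\underline\xi(t)$ whose labels are the old and new values of $x_j$ occupy neighbouring sites. Let $X_j(t)$ be the site of the particle of $\underline\xi(t)$ with label $x_j(t)$; $X_1(t)<\dots<X_d(t)$ are the positions of the second class particles. Put $\underline\eta(t)=\underline\xi(t)-\sum_{j=1}^d\underline\delta_{X_j(t)}$, where $\underline\delta_i$ is the configuration with a single particle, at site $i$. The coupled system is stationary if the law of $(\underline\xi(t),\underline x(t))$ does not depend on $t$; $\underline\xi,\underline\eta,\underline x,\underline X$ denote the values at a fixed time. *)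

(* Defs.v *)
From HB Require Import structures.
From mathcomp Require Export all_boot all_order all_algebra finmap.
From mathcomp Require Export all_classical all_reals all_analysis.

Set Implicit Arguments.
Unset Strict Implicit.
Unset Printing Implicit Defensive.

Export Order.TTheory GRing.Theory Num.Theory.
Export numFieldNormedType.Exports.

Local Open Scope classical_set_scope.
Local Open Scope ring_scope.

(** * Markov jump processes on a countable state space

    The states form a [choiceType] [S] carrying the discrete sigma-algebra;
    [r a b] is the rate of the jump from [a] to [b], for [a != b]; time is
    [t : R] with [0 <= t]. *)

Definition transition_function (R : realType) (S : choiceType)
    (p : R -> S -> S -> R) : Prop :=
  [/\ forall t a b, 0 <= t -> 0 <= p t a b,
      forall t a, 0 <= t -> (\esum_(b in [set: S]) (p t a b)%:E = 1)%E,
      forall a b, p 0 a b = (a == b)%:R &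
      forall s t a c, 0 <= s -> 0 <= t ->
        ((p (s + t) a c)%:E = \esum_(b in [set: S]) (p s a b * p t b c)%:E)%E].

(** The derivative of the transition function at time [0] is the Q-matrix
    with off-diagonal entries [r a b] and diagonal entries minus the total
    exit rate. *)
Definition has_jump_rates (R : realType) (S : choiceType)
    (p : R -> S -> S -> R) (r : S -> S -> R) : Prop :=
  (forall a b, a != b -> p h a b / h @[h --> 0^'+] --> r a b) /\
  (forall a, ((1 - p h a a) / h)%:E @[h --> 0^'+] -->
             (\esum_(b in [set b | b != a]) (r a b)%:E)%E).

(** Right-continuity and existence of left limits for the discrete topology;
    by compactness there are finitely many jumps in bounded time intervals. *)
Definition step_path (R : realType) (S : choiceType) (f : R -> S) : Prop :=
  (forall t, 0 <= t -> \forall s \near t^'+, f s = f t) /\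
  (forall t, 0 < t -> exists a, \forall s \near t^'-, f s = a).

Section jump_process.
Context {R : realType} {dT : measure_display} {T : measurableType dT}.
Context {S : choiceType}.
Variable P : probability T R.
Implicit Types (Z : R -> T -> S) (p : R -> S -> S -> R) (r : S -> S -> R).

Definition past_event Z (t : R) : set (set T) :=
  <<s [set A | exists u B, [/\ 0 <= u, u <= t & A = Z u @^-1` B]] >>.

Definition markov_with_transition p Z : Prop :=
  forall t h a b A, 0 <= t -> 0 <= h -> past_event Z t A ->
    (P (A `&` Z t @^-1` [set a] `&` Z (t + h)%R @^-1` [set b]) =
     P (A `&` Z t @^-1` [set a]) * (p h a b)%:E)%E.

Definition markov_jump_process r Z : Prop :=
  [/\ forall t (B : set S), 0 <= t -> measurable (Z t @^-1` B),
      {ae P, forall w, step_path (Z ^~ w)} &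
      exists p, [/\ transition_function p, has_jump_rates p r &
                    markov_with_transition p Z]].

Definition stationary Z : Prop :=
  forall t (B : set S), 0 <= t -> P (Z t @^-1` B) = P (Z 0 @^-1` B).

End jump_process.

(** * Particle configurations *)

Definition config := int -> bool.

Definition Omega : set config :=
  [set z : config | finite_set [set i : int | i <= 0 /\ z i] /\
                    finite_set [set i : int | 1 <= i /\ ~~ z i]].

(** The number of particles strictly to the left of site [i]. The set is
    finite for [z] in [Omega] ([fset_set] of an infinite set is empty). *)
Definition label (z : config) (i : int) : nat :=
  #|` fset_set [set j : int | j < i /\ z j]|.

(** For [z] in [Omega] every [k : nat] is the label of exactly one particle,
    so that the default value [0] is never used. *)
Definition site (z : config) (k : nat) : int :=
  xget 0 [set i : int | z i /\ label z i = k].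

Definition exchange (z : config) (i : int) : config :=
  fun k => if k == i then z (i + 1) else if k == i + 1 then z i else z k.

Definition right_jump (z z' : config) : Prop :=
  exists i : int, [/\ z i, ~~ z (i + 1) & z' = exchange z i].

Definition left_jump (z z' : config) : Prop :=
  exists i : int, [/\ z (i + 1), ~~ z i & z' = exchange z i].

Definition asep_rate (R : realType) (q : R) (z z' : config) : R :=
  (`[< right_jump z z' >])%:R + q * (`[< left_jump z z' >])%:R.

(** [mu_law P q c xi]: under [P], the random configuration [xi] has law
    mu^c, i.e. its coordinates are independent Bernoulli variables. *)
Definition mu_density (R : realType) (q c : R) (i : int) : R :=
  q `^ (c - i%:~R) / (1 + q `^ (c - i%:~R)).

Definition mu_law (R : realType) (dT : measure_display) (T : measurableType dT)
    (P : probability T R) (q c : R) (xi : T -> config) : Prop :=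
  forall (F : {fset int}) (b : int -> bool),
    P [set w | forall i, i \in F -> xi w i = b i] =
    (\prod_(i <- F) (if b i then mu_density q c i
                     else 1 - mu_density q c i))%:E.

(** * The coupled system *)

(** Labels are nonnegative, so they are taken in [nat] rather than [int]. *)
Definition Zplus (d : nat) : set {ffun 'I_d -> nat} :=
  [set x : {ffun 'I_d -> nat} | forall i j : 'I_d, (i < j)%N -> (x i < x j)%N].

Arguments Zplus d : clear implicits.

Definition coupled_state (d : nat) : choiceType := (Omega * Zplus d)%type.

Definition set_label (d : nat) (x : {ffun 'I_d -> nat}) (j : 'I_d) (k : nat) :
  {ffun 'I_d -> nat} := [ffun i => if i == j then k else x i].

Definition neighbours (z : config) (k l : nat) : Prop :=
  `|site z k - site z l| = 1.

Definition label_up (d : nat) (z : config) (x x' : {ffun 'I_d -> nat}) : Prop :=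
  exists j : 'I_d, [/\ forall i, x i != (x j).+1,
                       neighbours z (x j) (x j).+1 &
                       x' = set_label x j (x j).+1].

Definition label_down (d : nat) (z : config) (x x' : {ffun 'I_d -> nat}) :
    Prop :=
  exists j : 'I_d, [/\ (0 < x j)%N, forall i, x i != (x j).-1,
                       neighbours z (x j) (x j).-1 &
                       x' = set_label x j (x j).-1].

Definition label_rate (R : realType) (d : nat) (q : R) (z : config)
    (x x' : {ffun 'I_d -> nat}) : R :=
  q * (`[< label_up z x x' >])%:R + (`[< label_down z x x' >])%:R.

Definition coupled_rate (R : realType) (d : nat) (q : R)
    (s s' : coupled_state d) : R :=
  (s'.2 == s.2)%:R * asep_rate q (val s.1) (val s'.1) +
  (s'.1 == s.1)%:R * label_rate q (val s.1) (val s.2) (val s'.2).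

Definition second_class_position (d : nat) (s : coupled_state d) (j : 'I_d) :
  int := site (val s.1) (val s.2 j).

(* Main.v *)
Require Import Defs.
From mathcomp Require Import ring lra zify.
Set Implicit Arguments.
Unset Strict Implicit.
Unset Printing Implicit Defensive.
Local Open Scope classical_set_scope.
Local Open Scope ring_scope.

(** The weights [mu^c(z) * q ^ (x_1 + ... + x_d)] are reversible for the coupled
    rates. A stationary law [pi] satisfies [pi Q <= 0] (only an inequality, since
    [Q] is unbounded), so that its density [u] with respect to these weights is
    superharmonic. The total flow of the weights is finite, and a bounded convex
    function of [u] then shows that [u] is constant along jumps. For fixed [z] all
    the [(z, x)] are connected, hence the labels are independent of the
    configuration and [pi] is the normalized product. The law of the positions is
    thus proportional to the [mu^c]-mean of
    [prod_j (z (m j) * q ^ label z (m j))], whose factors over the sites telescope. *)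

(** * Sums over arbitrary index sets *)

Section esum_complements.
Context {R : realType}.
Local Open Scope ereal_scope.

(** The exit rate of a configuration grows with its number of interfaces, which is unbounded on
    [Omega]. Nothing is known about the summability of [u] against the flow, so the Dirichlet form
    of [u] cannot be tested with [u] itself. The function [1 / (1 + u)] takes values in []0, 1]], so
    the sums formed with it are dominated by the total flow, and this flow is finite because
    particles far to the left and holes far to the right have geometrically small probability.

    The mass of a single configuration is an infinite product; only its ratios along jumps are
    computed, as limits of ratios of cylinder probabilities, and states of weight zero are treated
    apart. Once [u (z, x)] is known not to depend on [x], the marginal law of the configuration
    fixes its value for each [z] separately.

    In the final formula, [prod (1 - q ^ i)] comes from the normalization of the labels. The power
    [q ^ (d choose 2)] in that normalization cancels against the shifts of the exponents in the
    telescoping product. *)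

Lemma esum_ge_term (I : choiceType) (D : set I) (f : I -> \bar R) i :
  D i -> 0 <= f i -> f i <= \esum_(j in D) f j.
Proof.
move=> Di fi0; apply: esum_ge; exists [set i]; last by rewrite fsbig_set1.
by split=> // j ->.
Qed.

Lemma esum_mkpoint (I : choiceType) (i : I) (f : I -> \bar R) :
  0 <= f i -> \esum_(j in [set: I]) (if j == i then f j else 0) = f i.
Proof.
move=> fi0; rewrite -[RHS](esum_set1 fi0) [RHS]esum_mkcond.
by apply: eq_esum => j _; rewrite in_set1.
Qed.

Lemma esum_exchange (I J : choiceType) (f : I -> J -> \bar R) :
  (forall i j, 0 <= f i j) ->
  \esum_(i in [set: I]) \esum_(j in [set: J]) f i j =
  \esum_(j in [set: J]) \esum_(i in [set: I]) f i j.
Proof.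
move=> f0; rewrite !esum_esum//.
rewrite (reindex_esum ([set: J] `*`` (fun=> [set: I])) _
  (fun x => (x.2, x.1)))//; split=> //=.
- by move=> [i1 j1] [i2 j2] _ _ [-> ->].
- by move=> [i j] _; exists (j, i).
Qed.

Lemma esum_pair (I J : choiceType) (f : I * J -> \bar R) :
  (forall k, 0 <= f k) ->
  \esum_(k in [set: I * J]) f k =
  \esum_(i in [set: I]) \esum_(j in [set: J]) f (i, j).
Proof.
move=> f0; rewrite esum_esum//.
have -> : [set: I] `*`` (fun=> [set: J]) = [set: I * J] by apply/seteqP; split.
by apply: eq_esum => -[].
Qed.

Lemma ge0_esumZl (I : choiceType) (D : set I) (k : R) (f : I -> \bar R) :
  (0 <= k)%R -> (forall i, 0 <= f i) ->
  \esum_(i in D) (k%:E * f i) = k%:E * \esum_(i in D) f i.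
Proof.
have le_esumZl (c : R) g : (0 <= c)%R -> (forall i, 0 <= g i) ->
    \esum_(i in D) (c%:E * g i) <= c%:E * \esum_(i in D) g i.
  move=> c0 g0; apply: ge_ereal_sup => _ [X [finX XD] <-].
  rewrite -ge0_mule_fsumr// lee_wpmul2l// ?lee_fin// ereal_sup_ubound//=.
  by exists X.
move=> k0 f0; apply/eqP; rewrite eq_le le_esumZl//=.
have [->|kn0] := eqVneq k 0%R.
  by rewrite mul0e; apply: esum_ge0 => i _; rewrite mul0e.
have kp : (0 < k)%R by rewrite lt0r kn0.
rewrite -lee_pdivlMl// (le_trans _ (le_esumZl (k^-1)%R _ _ _)) ?invr_ge0//.
  by apply: le_esum => i _; rewrite muleA -EFinM mulVf// mul1e.
by move=> i; rewrite mule_ge0// lee_fin.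
Qed.

End esum_complements.

(* With [w = 1 / (1 + u)], a convex decreasing function of [u], superharmonicity
   of [u] makes [w] subharmonic; by symmetry of [s] the total of
   [s a b * (w b - w a)] vanishes, so the defects of convexity all vanish. *)
Lemma superharmonic_const (R : realType) (S : choiceType) (s : S -> S -> R)
    (u : S -> R) :
  (forall a b, 0 <= s a b) -> (forall a b, s a b = s b a) ->
  (forall a, 0 <= u a) ->
  (\esum_(a in [set: S]) \esum_(b in [set: S]) (s a b)%:E < +oo)%E ->
  (forall a, \esum_(b in [set: S]) (s a b * u b)%:E <=
             \esum_(b in [set: S]) (s a b * u a)%:E)%E ->
  forall a b, 0 < s a b -> u a = u b.
Proof.
move=> s0 ssym u0 sfin usup.
pose w a := (1 + u a)^-1.
have w0 a : 0 < w a by rewrite invr_gt0 ltr_pwDl.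
have w1 a : w a <= 1 by rewrite invf_le1 ?lerDl// ltr_pwDl.
pose D a b := (u b - u a) ^+ 2 * w a ^+ 2 * w b.
have D0 a b : 0 <= D a b.
  by apply: mulr_ge0; [apply: mulr_ge0; exact: sqr_ge0 | exact: ltW].
(* Exact second order Taylor formula for [1 / (1 + u)] at [u a], with remainder [D a b]. It is
   arranged with nonnegative terms only, so that it can be summed in the extended reals. *)
have wE a b : w b + w a ^+ 2 * u b = w a + D a b + w a ^+ 2 * u a.
  have := u0 a; have := u0 b; rewrite /D /w => ub ua.
  by field; rewrite !lt0r_neq0 ?ltr_pwDl.
have rowfin a : (\esum_(b in [set: S]) (s a b)%:E < +oo)%E.
  apply: le_lt_trans sfin.
  apply: (esum_ge_term (f := fun a => \esum_(b in setT) (s a b)%:E)%E) => //.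
  by apply: esum_ge0 => b _; rewrite lee_fin.
have ge0M a b c : (0 <= c)%R -> (0 <= (s a b * c)%:E)%E.
  by move=> c0; rewrite lee_fin mulr_ge0.
have row a : (\esum_(b in [set: S]) (s a b * w a)%:E +
              \esum_(b in [set: S]) (s a b * D a b)%:E <=
              \esum_(b in [set: S]) (s a b * w b)%:E)%E.
  have wa0 := ltW (w0 a); have wa20 : 0 <= w a ^+ 2 by rewrite sqr_ge0.
  have esumZ c : 0 <= c ->
      (\esum_(b in [set: S]) (s a b * c)%:E =
       c%:E * \esum_(b in [set: S]) (s a b)%:E)%E.
    move=> c0; rewrite -ge0_esumZl// => [|b]; last by rewrite lee_fin.
    by apply: eq_esum => b _; rewrite mulrC EFinM.
  have fin : \esum_(b in [set: S]) (s a b * (w a ^+ 2 * u a))%:E \is a fin_num.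
    rewrite esumZ ?mulr_ge0// fin_numM// ge0_fin_numE//.
    by apply: esum_ge0 => b _; rewrite lee_fin.
  rewrite -(leeD2rE _ _ fin) -[X in (X + _ <= _)%E]esumD; last 2 first.
  - by move=> b _; apply: ge0M.
  - by move=> b _; apply: ge0M.
  rewrite -[leLHS]esumD; last 2 first.
  - by move=> b _; rewrite -EFinD lee_fin addr_ge0// mulr_ge0.
  - by move=> b _; apply: ge0M; exact: mulr_ge0.
  apply: (@le_trans _ _ (\esum_(b in [set: S]) (s a b * w b)%:E +
      \esum_(b in [set: S]) (s a b * (w a ^+ 2 * u b))%:E)%E).
    rewrite -esumD; last 2 first.
    - by move=> b _; apply: ge0M; rewrite ltW.
    - by move=> b _; apply: ge0M; exact: mulr_ge0.
    apply: le_esum => b _; rewrite -!EFinD lee_fin -!mulrDr.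
    by rewrite wE.
  rewrite leeD2l//.
  rewrite [leLHS](_ : _ =
     ((w a ^+ 2)%:E * \esum_(b in [set: S]) (s a b * u b)%:E)%E); last first.
    rewrite -ge0_esumZl// => [|b]; last exact: ge0M.
    by apply: eq_esum => b _; rewrite -EFinM; congr EFin; ring.
  rewrite [leRHS](_ : _ =
     ((w a ^+ 2)%:E * \esum_(b in [set: S]) (s a b * u a)%:E)%E); last first.
    rewrite -ge0_esumZl// => [|b]; last exact: ge0M.
    by apply: eq_esum => b _; rewrite -EFinM; congr EFin; ring.
  by rewrite lee_wpmul2l// lee_fin.
have tot : (\esum_(a in [set: S]) \esum_(b in [set: S]) (s a b * w a)%:E +
            \esum_(a in [set: S]) \esum_(b in [set: S]) (s a b * D a b)%:E <=
            \esum_(a in [set: S]) \esum_(b in [set: S]) (s a b * w a)%:E)%E.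
  rewrite -esumD; last 2 first.
  - by move=> a _; apply: esum_ge0 => b _; apply: ge0M; rewrite ltW.
  - by move=> a _; apply: esum_ge0 => b _; apply: ge0M.
  rewrite [leRHS]esum_exchange//; last by move=> a b; apply: ge0M; rewrite ltW.
  apply: le_esum => a _; apply: le_trans (row a) _.
  by apply: le_esum => b _; rewrite ssym.
have fin : \esum_(a in [set: S]) \esum_(b in [set: S]) (s a b * w a)%:E
    \is a fin_num.
  rewrite ge0_fin_numE; last first.
    by apply: esum_ge0 => a _; apply: esum_ge0 => b _; apply: ge0M; rewrite ltW.
  apply: le_lt_trans sfin; apply: le_esum => a _; apply: le_esum => b _.
  by rewrite lee_fin ler_piMr.
move=> a b sab.
have : ((s a b * D a b)%:E <= 0)%E.
  apply: (@le_trans _ _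
    (\esum_(a in [set: S]) \esum_(b in [set: S]) (s a b * D a b)%:E)%E).
    apply: (@le_trans _ _ (\esum_(b in [set: S]) (s a b * D a b)%:E)%E).
      by apply: (esum_ge_term (f := fun b => (s a b * D a b)%:E)) => //; apply: ge0M.
    apply: (esum_ge_term
       (f := fun a => \esum_(b in [set: S]) (s a b * D a b)%:E)%E) => //.
    by apply: esum_ge0 => c _; apply: ge0M.
  by rewrite -(leeD2lE _ _ fin) adde0.
rewrite lee_fin pmulr_rle0// /D -mulrA pmulr_lle0; last first.
  by rewrite mulr_gt0 ?exprn_gt0.
move=> le0; apply/eqP; rewrite eq_sym -subr_eq0 -sqrf_eq0 eq_le le0.
exact: sqr_ge0.
Qed.

(** * Probability flow of a stationary jump process *)

Lemma measure_bigcup_countable (d : measure_display) (T : measurableType d)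
    (R : realType) (P : {measure set T -> \bar R}) (I : choiceType)
    (D : set I) (F : I -> set T) :
  countable D -> (forall i, D i -> measurable (F i)) -> trivIset D F ->
  P (\bigcup_(i in D) F i) = (\esum_(i in D) P (F i))%E.
Proof.
move=> /countable_injP[f finj] mF tF.
(* The injection [f] codes [D] by natural numbers; the fibre over a code is a single index, so the
   union becomes a sequence of disjoint sets. *)
rewrite -[\bigcup_(i in D) F i](_ :
    \bigcup_(n in f @` D) (\bigcup_(i in D `&` [set i | f i = n]) F i) = _).
  have fE n : D n -> \bigcup_(i in D `&` [set i | f i = f n]) F i = F n.
    move=> Dn; rewrite (_ : _ `&` _ = [set n]) ?bigcup_set1//.
    apply/seteqP; split=> [i [Di /= fin]|i ->//].
    by apply: finj; rewrite ?inE.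
  rewrite measure_bigcup; last 2 first.
  - by move=> n [i Di <-]; rewrite fE//; exact: mF.
  - apply/trivIsetP => _ _ [i Di <-] [j Dj <-] ij; rewrite !fE//.
    by move/trivIsetP : tF; apply => //; apply: contra_neq ij => ->.
  rewrite nneseries_esum// (_ : [set x | x \in f @` D] = f @` D); last first.
    by apply/seteqP; split=> x /=; rewrite inE.
  rewrite esum_image//.
  by apply: eq_esum => i Di; rewrite fE.
apply/seteqP; split=> [x [n _ [i [Di _] Fix]]|x [i Di Fix]].
  by exists i.
by exists (f i); [exists i|exists i].
Qed.

Section countable_law.
Context {R : realType} {dT : measure_display} {T : measurableType dT}.
Context {S : choiceType}.
Variables (P : probability T R) (Y : T -> S).
Hypothesis mY : forall B : set S, measurable (Y @^-1` B).
Hypothesis cS : countable [set: S].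

Definition mass (a : S) : R := fine (P (Y @^-1` [set a])).

Lemma massE a : (mass a)%:E = P (Y @^-1` [set a]).
Proof. by rewrite fineK// fin_num_measure. Qed.

Lemma mass_ge0 a : 0 <= mass a.
Proof. by rewrite fine_ge0. Qed.

Lemma law_esum (B : set S) : P (Y @^-1` B) = (\esum_(a in B) (mass a)%:E)%E.
Proof.
rewrite (eq_esum (fun a _ => massE a)) -measure_bigcup_countable//.
- congr (P _); apply/seteqP; split=> [w Bw|w [a Ba /= wa]].
    by exists (Y w).
  by rewrite /= wa.
- by apply: sub_countable cS; apply: subset_card_le.
- by apply/trivIsetP => a b _ _; apply: contra_neqP => /eqP/set0P[w [/= <- <-]].
Qed.

End countable_law.

Section stationary_flow.
Context {R : realType} {dT : measure_display} {T : measurableType dT}.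
Context {S : choiceType}.
Variables (P : probability T R) (r : S -> S -> R) (Z : R -> T -> S).
Hypothesis Z_process : markov_jump_process P r Z.
Hypothesis Z_stationary : stationary P Z.

(* Only an inequality, as in Fatou's lemma: the limit [h -> 0+] is taken for each
   finite set of sources [a]. *)
Lemma stationary_flow_le (b : S) :
  (\esum_(a in [set a | a != b]) (mass P (Z 0) a * r a b)%:E <=
   (mass P (Z 0) b)%:E * \esum_(a in [set a | a != b]) (r b a)%:E)%E.
Proof.
case: Z_process => mZ _ [p [[p0 _ _ _] [poff pdiag] pZ]].
have mZ0 : forall B : set S, measurable (Z 0 @^-1` B) by move=> B; exact: mZ.
have joint h a c : 0 <= h ->
    (P (Z 0 @^-1` [set a] `&` Z h @^-1` [set c]) =
     (mass P (Z 0) a * p h a c)%:E)%E.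
  move=> h0; have := pZ 0 h a c setT (lexx _) h0.
  rewrite add0r !setTI EFinM massE//; apply.
  by apply: sub_sigma_algebra; exists 0, setT.
apply: ge_ereal_sup => _ [X [finX Xb] <-].
have sumX (f : S -> \bar R) :
    (\sum_(a \in X) f a = \sum_(a <- fset_set X | a != b) f a)%E.
  rewrite fsbig_finite//= big_seq [RHS]big_seq_cond; apply: eq_bigl => a.
  rewrite in_fset_set//; have [aX|//] := boolP (a \in X).
  by have /= -> := Xb _ (set_mem aX).
rewrite sumX.
(* The paths that start in [X] or in [b] and are in [b] at time [h] have total probability at most
   [pi b], by stationarity. Subtract the term of the paths starting in [b] and divide by [h]. *)
have main h : 0 < h ->
    (\sum_(a <- fset_set X | a != b) (mass P (Z 0) a * (p h a b / h))%:E <=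
     (mass P (Z 0) b)%:E * ((1 - p h b b) / h)%:E)%E.
  move=> h0; have hh := ltW h0.
  have : (\sum_(a \in X `|` [set b]) (mass P (Z 0) a * p h a b)%:E <=
          (mass P (Z 0) b)%:E)%E.
    rewrite (eq_fsbigr (fun a => P (Z 0 @^-1` [set a] `&` Z h @^-1` [set b]))).
      rewrite -measure_fin_bigcup ?finite_setU//; last 2 first.
      - apply/trivIsetP => a c _ _; apply: contra_neqP.
        by move=> /eqP/set0P[w [[<- _] [<- _]]].
      - by move=> a _; apply: measurableI; [exact: mZ0|exact: mZ].
      rewrite massE// -(Z_stationary [set b] hh) le_measure ?inE//; last first.
      - by move=> w [a _ []].
      - exact: mZ.
      - apply: fin_bigcup_measurable; first by rewrite finite_setU.
        by move=> a _; apply: measurableI; [exact: mZ0|exact: mZ].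
    by move=> a _; rewrite joint.
  rewrite fsbigU0//; last by move=> a [/Xb /= /eqP].
  rewrite fsbig_set1 sumX /= !sumEFin -EFinM -EFinD !lee_fin => le1.
  rewrite mulrA ler_pdivlMr// mulr_suml mulrBr mulr1.
  rewrite (eq_bigr (fun a => mass P (Z 0) a * p h a b)); last first.
    by move=> a _; rewrite mulrA mulfVK// gt_eqF.
  by rewrite lerBrDr.
apply: (@lee_cvg_to _ (0^'+) _ _
  (fun h => \sum_(a <- fset_set X | a != b) (mass P (Z 0) a * (p h a b / h))%:E)%E
  (fun h => (mass P (Z 0) b)%:E * ((1 - p h b b) / h)%:E)%E).
- apply: cvg_nnesum => a ab.
    near=> h; rewrite lee_fin mulr_ge0 ?mass_ge0// divr_ge0 ?p0//.
  apply: cvg_EFin; first by near=> h.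
  by apply: cvgM; [exact: cvg_cst|exact: poff].
- by apply: cvgeZl => //; exact: pdiag.
- by near=> h; apply: main; near: h; exact: nbhs_right_gt.
Unshelve. all: by end_near. Qed.

End stationary_flow.

(** * Labels and sites *)

Lemma finite_set_int_bounded (A : set int) :
  finite_set A -> exists n : nat, forall i, A i -> `|i| <= n%:Z.
Proof.
move=> finA; exists (\max_(i <- fset_set A) `|i|%N)%N => i Ai.
rewrite -abszE lez_nat; apply: (leq_bigmax_seq (F := fun i : int => `|i|%N)) => //.
by rewrite in_fset_set// inE.
Qed.

Lemma finite_set_int_itv (m : int) (n : nat) :
  finite_set [set i : int | m <= i < m + n%:Z].
Proof.
apply: (@sub_finite_set _ _ ((fun k : nat => m + k%:Z) @` `I_n)).
  move=> i /= /andP[mi im]; exists `|i - m|%N => /=; lia.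
exact: finite_image.
Qed.

Section configurations.
Implicit Types (z : config) (i j : int) (k : nat).

Lemma Omega_bounded z : Omega z -> exists n : nat,
  (forall i, i < - n%:Z -> ~~ z i) /\ (forall i, n%:Z < i -> z i).
Proof.
move=> [/finite_set_int_bounded[n1 H1] /finite_set_int_bounded[n2 H2]].
exists (n1 + n2)%N; split=> i hi.
- by apply/negP => zi; have := H1 i (conj (_ : i <= 0) zi); lia.
- apply/negPn/negP => zi; have := H2 i (conj (_ : 1 <= i) zi); lia.
Qed.

Lemma finite_left z i : Omega z -> finite_set [set j | j < i /\ z j].
Proof.
move=> /Omega_bounded[n [zl _]].
apply: sub_finite_set (finite_set_int_itv (- n%:Z) (n + `|i|)%N) => j /= [ji zj].
have : ~ j < - n%:Z by move=> /zl; rewrite zj.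
lia.
Qed.

Lemma label_local z z' i : (forall j, j < i -> z j = z' j) ->
  label z i = label z' i.
Proof.
move=> zz'; rewrite /label; congr (#|` fset_set _|).
by apply/seteqP; split=> j /= [ji]; rewrite zz'.
Qed.

Lemma label_le z i j : Omega z -> i <= j -> (label z i <= label z j)%N.
Proof.
move=> Oz ij; apply: fsubset_leq_card; apply/fsubsetP => k.
rewrite !in_fset_set ?inE /=; do ?exact: finite_left.
by move=> [ki zk]; split=> //; exact: lt_le_trans ij.
Qed.

Lemma labelS z i : Omega z -> label z (i + 1) = (label z i + z i)%N.
Proof.
move=> Oz; rewrite /label.
case: (boolP (z i)) => zi.
  rewrite (_ : [set j | j < i + 1 /\ z j] = i |` [set j | j < i /\ z j]).
    rewrite fset_setU1 ?cardfsU1; last exact: finite_left.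
    rewrite in_fset_set; last exact: finite_left.
    by rewrite memNset 1?addnC//= => -[]; rewrite ltxx.
  apply/seteqP; split=> j /=.
    by move=> [ji zj]; have [->|ne] := eqVneq j i; [left|right; split=> //; lia].
  by move=> [->|[ji zj]]; split=> //; lia.
rewrite addn0; congr (#|` fset_set _|).
apply/seteqP; split=> j /= [ji zj]; split=> //; last lia.
have : j != i by apply: contraNneq zi => <-.
lia.
Qed.

Lemma label_lt z i j : Omega z -> z i -> i < j -> (label z i < label z j)%N.
Proof.
move=> Oz zi ij; apply: leq_trans (label_le Oz (_ : i + 1 <= j)); last lia.
by rewrite labelS// zi addn1.
Qed.

Lemma label_inj z i j : Omega z -> z i -> z j -> label z i = label z j -> i = j.
Proof.
move=> Oz zi zj; have [/(label_lt Oz zi)|/(label_lt Oz zj)|//] := ltgtP i j; lia.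
Qed.

(** Read from left to right, the label starts at [0], grows by at most one per site and is
    unbounded; the site just before it first exceeds [k] carries the particle with label [k]. *)
Lemma exists_label z k : Omega z -> exists i, z i /\ label z i = k.
Proof.
move=> Oz; have [n [zl zr]] := Omega_bounded Oz.
have label0 : label z (- n%:Z) = 0%N.
  rewrite /label (_ : [set j | _] = set0) ?fset_set0//.
  by apply/seteqP; split=> // j /= [/zl/negP].
have unbounded m : (m <= label z (n%:Z + 1 + m%:Z))%N.
  elim: m => // m IH; rewrite (_ : _ + _%:Z = n%:Z + 1 + m%:Z + 1); last lia.
  by rewrite labelS// zr ?addn1//; lia.
have ex : exists m : nat, (k < label z (- n%:Z + m%:Z))%N.
  exists (n + n + 1 + k.+1)%N; apply: leq_trans (unbounded k.+1) _.
  by apply: label_le => //; lia.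
case: (ex_minnP ex) => -[|m] km kmin; first by move: km; rewrite addr0 label0.
have := kmin m; rewrite ltnn => /contraFN/(_ erefl).
rewrite -leqNgt => mk; exists (- n%:Z + m%:Z); move: km mk.
rewrite (_ : _ + _%:Z = - n%:Z + m%:Z + 1); last lia.
by rewrite labelS//; case: (z _) => /=; lia.
Qed.

Lemma siteP z k i : Omega z -> (site z k = i) <-> (z i /\ label z i = k).
Proof.
move=> Oz; have [j [zj lj]] := exists_label k Oz.
have [zs ls] : [set i | z i /\ label z i = k] (site z k).
  by apply: xgetPex; exists j.
split=> [<-//|[zi li]]; apply: (label_inj Oz) => //; lia.
Qed.

Lemma exchange_neq z i : z i != z (i + 1) -> exchange z i != z.
Proof.
by apply: contra_neq => /(congr1 (@^~ i)); rewrite /exchange eqxx.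
Qed.

Lemma exchangeK z i : exchange (exchange z i) i = z.
Proof.
apply/funext => k; rewrite /exchange !eqxx.
have [->|ki] := eqVneq k i; last by have [->|//] := eqVneq k (i + 1).
by case: eqVneq => //; lia.
Qed.

Lemma exchange_Omega z i : Omega z -> Omega (exchange z i).
Proof.
have fin2 : finite_set [set i; i + 1] by [].
move=> [fl fr]; split; [apply: sub_finite_set (_ : finite_set (_ `|` [set i; i + 1])) |
   apply: sub_finite_set (_ : finite_set (_ `|` [set i; i + 1]))];
  rewrite ?finite_setU; last first.
- by split; [exact: fr|].
- rewrite /exchange => k /= [k1]; case: eqVneq => [->|ki]; first by right; left.
  by case: eqVneq => [->|_ zk]; [right; right|left].
- by split; [exact: fl|].
- rewrite /exchange => k /= [k1]; case: eqVneq => [->|ki]; first by right; left.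
  by case: eqVneq => [->|_ zk]; [right; right|left].
Qed.

Lemma left_jump_right z z' : left_jump z z' <-> right_jump z' z.
Proof.
split=> -[i [zi zi1 e]]; exists i; rewrite e exchangeK; split=> //;
  rewrite /exchange eqxx//; case: eqVneq => //; lia.
Qed.

Lemma right_jump_neq z z' : right_jump z z' -> z != z'.
Proof.
move=> [i [zi zi1 ->]]; rewrite eq_sym exchange_neq// zi; exact: contraNneq zi1 => <-.
Qed.

End configurations.

Lemma Zplus_inj (d : nat) (x : {ffun 'I_d -> nat}) : Zplus d x -> injective x.
Proof.
move=> Zx i j xij; apply/val_inj; by have [/Zx|/Zx|//] := ltngtP i j; rewrite xij ltnn.
Qed.

Lemma Zplus_ge (d : nat) (x : {ffun 'I_d -> nat}) : Zplus d x ->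
  forall j : 'I_d, (j <= x j)%N.
Proof.
move=> Zx [j jd]; elim: j jd => [//|j IH] jd /=.
by apply: leq_ltn_trans (IH (ltnW jd)) _; apply: Zx => /=.
Qed.

(** * Connectivity in the labels *)

Lemma asep_rate_ge0 (R : realType) (q : R) z z' : 0 <= q -> 0 <= asep_rate q z z'.
Proof. by move=> q0; rewrite addr_ge0// mulr_ge0. Qed.

Lemma label_rate_ge0 (R : realType) (d : nat) (q : R) z (x x' : {ffun 'I_d -> nat}) :
  0 <= q -> 0 <= label_rate q z x x'.
Proof. by move=> q0; rewrite addr_ge0// mulr_ge0. Qed.

Lemma coupled_rate_ge0 (R : realType) (d : nat) (q : R) (a b : coupled_state d) :
  0 <= q -> 0 <= coupled_rate q a b.
Proof.
by move=> q0; rewrite addr_ge0// mulr_ge0// ?asep_rate_ge0// label_rate_ge0.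
Qed.

Definition to_set_type (X : Type) (A : set X) (x : X) (Ax : A x) : A :=
  exist (fun y => y \in A) x (mem_set Ax).

Lemma set_typeP (X : Type) (A : set X) (x : A) : A (val x).
Proof. exact/set_mem/(valP x). Qed.

Lemma left_jump_rate (R : realType) (d : nat) (q : R) (z z' : Omega) (x : Zplus d) :
  0 < q -> left_jump (val z) (val z') ->
  0 < coupled_rate q ((z, x) : coupled_state d) (z', x).
Proof.
move=> q0 zz'; have q_ge0 := ltW q0.
rewrite /coupled_rate ltr_wpDr ?mulr_ge0 ?label_rate_ge0//=.
by rewrite eqxx mul1r /asep_rate (asboolT zz') mulr1 ltr_wpDl.
Qed.

Lemma label_up_rate (R : realType) (d : nat) (q : R) (z : Omega) (x x' : Zplus d) :
  0 < q -> label_up (val z) (val x) (val x') ->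
  0 < coupled_rate q ((z, x) : coupled_state d) (z, x').
Proof.
move=> q0 xx'; have q_ge0 := ltW q0.
rewrite /coupled_rate ltr_wpDl ?mulr_ge0 ?asep_rate_ge0//=.
by rewrite eqxx mul1r /label_rate (asboolT xx') mulr1 ltr_wpDr.
Qed.

Section connectivity.
Context {d : nat} {A : Type}.
Variable u : coupled_state d -> A.
(** Equality of [u] is symmetric, so left jumps and upward label moves also account for the reverse
    jumps. *)
Hypothesis left_jump_edge : forall (z z' : Omega) x,
  left_jump (val z) (val z') -> u (z, x) = u (z', x).
Hypothesis label_up_edge : forall z (x x' : Zplus d),
  label_up (val z) (val x) (val x') -> u (z, x) = u (z, x').
Implicit Types (z : Omega) (x : Zplus d).

(** Induction on the number [n] of holes between two consecutive particles. A left jump of the right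
    one closes a hole and keeps all labels; made once under [x] and once under [x'], it leads to the
    same configuration. When no hole is left, the label move is allowed. *)
Lemma label_up_close (n : nat) z (i : int) x x' (j : 'I_d) :
  val z i -> val z (i + 1 + n%:Z) ->
  (forall k, i < k < i + 1 + n%:Z -> ~~ val z k) ->
  val x j = label (val z) i -> (forall l, val x l != (val x j).+1) ->
  val x' = set_label (val x) j (val x j).+1 -> u (z, x) = u (z, x').
Proof.
elim: n z => [|n IH] z zi zn gap xj xl ex'.
  apply: label_up_edge; exists j; split=> //.
  have Oz : Omega (val z) by exact: set_typeP.
  rewrite /neighbours; have -> : site (val z) (val x j) = i by apply/siteP.
  have -> : site (val z) (val x j).+1 = i + 1.
    by apply/siteP => //; rewrite labelS// zi xj addn1; move: zn; rewrite addr0.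
  lia.
have Oz : Omega (val z) by exact: set_typeP.
pose z1 : Omega := to_set_type (exchange_Omega (i + 1 + n%:Z) Oz).
have z1E : val z1 = exchange (val z) (i + 1 + n%:Z) by [].
have en : i + 1 + n.+1%:Z = i + 1 + n%:Z + 1 by lia.
have zz1 : left_jump (val z) (val z1).
  by exists (i + 1 + n%:Z); split; rewrite // -?en// gap//; lia.
have loc k : k < i + 1 + n%:Z -> val z1 k = val z k.
  move=> ki; rewrite z1E /exchange; case: eqVneq => [|_]; first lia.
  by case: eqVneq => //; lia.
rewrite !(left_jump_edge _ zz1); apply: IH => //.
- by rewrite loc//; lia.
- by rewrite z1E /exchange eqxx -en.
- by move=> k /andP[ik kn]; rewrite loc// gap//; lia.
- by rewrite xj; apply: label_local => k ki; rewrite loc//; lia.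
Qed.

Lemma label_up_const z x x' (j : 'I_d) :
  (forall l, val x l != (val x j).+1) ->
  val x' = set_label (val x) j (val x j).+1 -> u (z, x) = u (z, x').
Proof.
have Oz : Omega (val z) by exact: set_typeP.
have [zi li] : val z (site (val z) (val x j)) /\
    label (val z) (site (val z) (val x j)) = val x j by apply/siteP.
have [zk lk] : val z (site (val z) (val x j).+1) /\
    label (val z) (site (val z) (val x j).+1) = (val x j).+1 by apply/siteP.
set i := site _ _ in zi li; set k := site _ _ in zk lk.
have ik : i < k.
  by rewrite ltNge; apply/negP => /(label_le Oz); rewrite li lk ltnn.
have kE : k = i + 1 + (absz (k - i - 1)%R)%:Z by lia.
apply: (@label_up_close (absz (k - i - 1)%R) _ i); rewrite -?kE// => l /andP[il lk'].
apply/negP => zl; have := label_lt Oz zi il; have := label_lt Oz zl lk'; lia.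
Qed.

Lemma Zplus_id : Zplus d [ffun j : 'I_d => j : nat].
Proof. by move=> i j; rewrite !ffunE. Qed.

(** Every label vector is joined to the smallest one, [0, ..., d - 1], by lowering one entry at a
    time; the induction is on the sum of the entries. *)
Lemma label_const z x x' : u (z, x) = u (z, x').
Proof.
pose x0 : Zplus d := to_set_type Zplus_id.
suff to_min y : u (z, y) = u (z, x0) by rewrite !to_min.
have [n] := ubnP (\sum_(j < d) val y j)%N; elim: n y => // n IH y yn.
have Zy : Zplus d (val y) by exact: set_typeP.
have [/forallP yid|] := boolP [forall j : 'I_d, val y j == j].
  by congr (u (_, _)); apply/val_inj/ffunP => j; rewrite ffunE; exact/eqP.
rewrite negb_forall => /existsP[j0 jy0].
(* For the least [j] with [y j != j], the entries before it are [0, ..., j - 1] and [y j > j]; hence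
   [y j - 1] is free and lowering [y j] keeps the vector increasing. *)
case: (@arg_minnP _ j0 (fun j => val y j != j) (@nat_of_ord d) jy0) => j jy jmin.
have yj : (j < val y j)%N by rewrite ltn_neqAle eq_sym jy Zplus_ge.
pose y1 := set_label (val y) j (val y j).-1.
have Zy1 : Zplus d y1.
  move=> i l il; rewrite !ffunE; have [ij|ij] := eqVneq i j.
    have lj : l != j by apply: contraTneq il => ->; rewrite ij ltnn.
    by rewrite (negbTE lj) (leq_ltn_trans (leq_pred _))// -ij Zy.
  have [lj|_] := eqVneq l j; last exact: Zy.
  have /eqP -> : val y i == i.
    by apply: contraLR il => /jmin; rewrite lj; lia.
  by move: il; rewrite lj; lia.
pose y1' : Zplus d := to_set_type Zy1.
rewrite -(IH y1'); last first.
  move: yn; rewrite ltnS; apply: leq_trans.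
  rewrite (bigD1 j)//= [in ltnRHS](bigD1 j)//= ffunE eqxx.
  rewrite (eq_bigr (sval y)); first by rewrite ltn_add2r prednK// (leq_trans _ yj).
  by move=> i ij; rewrite ffunE (negbTE ij).
symmetry; apply: (@label_up_const _ _ _ j).
  move=> l; rewrite /= !ffunE eqxx prednK; last exact: leq_trans yj.
  have [_|lj] := eqVneq l j; first by rewrite ltn_eqF// prednK// (leq_trans _ yj).
  by apply: contra_neq lj => /(Zplus_inj Zy).
apply/ffunP => l; rewrite /= !ffunE eqxx; have [->|//] := eqVneq l j.
by rewrite prednK// (leq_trans _ yj).
Qed.

End connectivity.

(** * Reversible weights *)

Lemma esum_set_typeT (R : realType) (X : choiceType) (A : set X) (f : X -> \bar R) :
  (\esum_(x in [set: A]) f (val x) = \esum_(x in A) f x)%E.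
Proof.
symmetry; apply: (reindex_esum [set: A] A); split.
- by move=> x _; exact: set_typeP.
- by move=> x y _ _; exact: val_inj.
- by move=> x Ax; exists (to_set_type Ax).
Qed.

Lemma esum_geometric (R : realType) (x : R) : 0 <= x -> x < 1 ->
  (\esum_(k in [set: nat]) (x ^+ k)%:E = ((1 - x)^-1)%:E)%E.
Proof.
move=> x0 x1; rewrite -nneseries_esumT; last by move=> n; rewrite lee_fin exprn_ge0.
have x1' : `|x| < 1 by rewrite ger0_norm.
have cg := @cvg_geometric_series R 1 x x1'.
rewrite -[(1 - x)^-1]mul1r -(cvg_lim _ cg)//.
rewrite -EFin_lim; last by apply/cvg_ex; eexists; exact: cg.
apply/congr_lim/funext => n /=; rewrite sumEFin; congr EFin.
by apply: eq_bigr => k _; rewrite /geometric /= mul1r.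
Qed.

Definition label_weight (R : realType) (d : nat) (q : R) (x : {ffun 'I_d -> nat}) : R :=
  q ^+ (\sum_(j < d) x j).

(** Generating function of the partitions into [d] distinct nonnegative parts,
    [q ^ (d choose 2) / (q; q)_d]. *)
Definition label_partition (R : realType) (d : nat) (q : R) : R :=
  q ^+ 'C(d, 2) / \prod_(i < d) (1 - q ^+ i.+1).

Section label_partition.
Context {R : realType}.
Variable q : R.
Hypotheses (q_gt0 : 0 < q) (q_lt1 : q < 1).

Lemma label_partition_gt0 d : 0 < label_partition d q.
Proof.
rewrite divr_gt0 ?exprn_gt0// prodr_gt0// => i _.
by rewrite subr_gt0 exprn_ilt1// ltW.
Qed.

(** A strictly increasing vector is its first entry [k] followed by a shorter increasing vector
    shifted by [k + 1], without further constraint. *)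
Let cons_label d (ky : nat * {ffun 'I_d -> nat}) : {ffun 'I_d.+1 -> nat} :=
  [ffun j => if unlift ord0 j is Some i then (ky.2 i + ky.1.+1)%N else ky.1].

Let cons_label_bij d :
  set_bij ([set: nat] `*` Zplus d) (Zplus d.+1) (@cons_label d).
Proof.
split.
- move=> [k y] [_ /= Zy] i j; rewrite !ffunE /=.
  case: unliftP => [i'|] ->; case: unliftP => [j'|] -> //=.
    by rewrite /bump /= !add1n ltnS ltn_add2r => /Zy.
  by move=> _; lia.
- move=> [k y] [k' y'] _ _ /= e.
  have ek : k = k'.
    by move/(congr1 (fun f : {ffun _ -> nat} => f ord0)) : e; rewrite !ffunE unlift_none.
  congr (_, _) => //; apply/ffunP => j.
  move/(congr1 (fun f : {ffun _ -> nat} => f (lift ord0 j))) : e.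
  by rewrite !ffunE liftK /= ek => /addIn.
- move=> x Zx; exists (x ord0, [ffun j => (x (lift ord0 j) - (x ord0).+1)%N]).
    split=> // i j ij; rewrite !ffunE.
    have := Zx (lift ord0 i) (lift ord0 j); have := Zx ord0 (lift ord0 i).
    by rewrite !lift0 => /(_ isT) + /(_ ij); lia.
  apply/ffunP => j; rewrite !ffunE; case: unliftP => [j'|] -> //=.
  by rewrite ffunE subnK//; apply: Zx.
Qed.

(** Splitting off the first entry [k] multiplies the weight by [q ^ d * (q ^ (d + 1)) ^ k]. The
    geometric series in [k] gives the new denominator, and the factors [q ^ d] accumulate to
    [q ^ (d choose 2)]. *)
Lemma label_weight_esum d :
  (\esum_(x in Zplus d) (label_weight q x)%:E = (label_partition d q)%:E)%E.
Proof.
elim: d => [|d IH].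
  rewrite (_ : Zplus 0 = [set [ffun=> 0%N]]); last first.
    by apply/seteqP; split=> [x _|x _ []//]; apply/ffunP => -[].
  rewrite esum_set1; last by rewrite lee_fin exprn_ge0// ltW.
  by rewrite /label_weight /label_partition !big_ord0 divr1.
rewrite (reindex_esum _ _ _ _ (@cons_label_bij d)).
have weightE k (y : {ffun 'I_d -> nat}) : label_weight q (cons_label (k, y)) =
    q ^+ d * (q ^+ d.+1) ^+ k * label_weight q y.
  rewrite /label_weight big_ord_recl !ffunE unlift_none /=.
  under eq_bigr do rewrite ffunE liftK /=.
  rewrite big_split/= sum_nat_const card_ord -exprM -!exprD; congr (_ ^+ _); lia.
rewrite (_ : _ `*` _ = [set: nat] `*`` (fun=> Zplus d))//.
have w0 y : 0 <= @label_weight R d q y by rewrite exprn_ge0// ltW.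
have c0 k : 0 <= q ^+ d * q ^+ d.+1 ^+ k by rewrite mulr_ge0// !exprn_ge0// ltW.
transitivity (\esum_(k in [set: nat]) \esum_(y in Zplus d)
    ((q ^+ d * q ^+ d.+1 ^+ k)%:E * (label_weight q y)%:E))%E.
  rewrite esum_esum; last by move=> k y _ _; rewrite mule_ge0// lee_fin.
  by apply: eq_esum => -[k y] _; rewrite weightE EFinM.
transitivity (\esum_(k in [set: nat])
    ((q ^+ d * label_partition d q)%:E * (q ^+ d.+1 ^+ k)%:E))%E.
  apply: eq_esum => k _; rewrite ge0_esumZl// IH -!EFinM; congr EFin; ring.
have qd1 : 0 <= q ^+ d.+1 < 1 by rewrite exprn_ge0 ?exprn_ilt1// ltW.
have /andP[qd_ge0 qd_lt1] := qd1.
rewrite ge0_esumZl//; last 2 first.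
- by rewrite mulr_ge0 ?exprn_ge0 ?ltW ?label_partition_gt0.
- by move=> k; rewrite lee_fin exprn_ge0.
rewrite esum_geometric// -EFinM; congr EFin.
rewrite /label_partition big_ord_recr/= binS bin1 exprD invfM.
by ring.
Qed.

End label_partition.

Definition coupled_weight (R : realType) (d : nat) (q : R) (mu : Omega -> R)
  (a : coupled_state d) : R := mu a.1 * label_weight q (val a.2).

Lemma neighboursC z k l : neighbours z k l <-> neighbours z l k.
Proof. by rewrite /neighbours distrC. Qed.

(** A move can be undone because the value it leaves is free afterwards: the entries of a vector in
    [Zplus] are distinct. *)
Lemma label_down_up (d : nat) z (x x' : {ffun 'I_d -> nat}) :
  Zplus d x -> Zplus d x' -> label_down z x x' <-> label_up z x' x.
Proof.
move=> Zx Zx'; split=> -[j].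
  move=> [xj0 xl nb e]; have ej : x' j = (x j).-1 by rewrite e ffunE eqxx.
  exists j; rewrite ej prednK//; split.
  - move=> l; rewrite e ffunE; have [_|lj] := eqVneq l j.
      by rewrite ltn_eqF ?prednK.
    by apply: contra_neq lj => /(Zplus_inj Zx).
  - exact/neighboursC.
  - apply/ffunP => l; rewrite e !ffunE; by have [->|//] := eqVneq l j.
move=> [xl nb e]; have ej : x j = (x' j).+1 by rewrite e ffunE eqxx.
exists j; rewrite ej; split=> //=.
- move=> l; rewrite e ffunE; have [_|lj] := eqVneq l j; first by rewrite gtn_eqF.
  by apply: contra_neq lj => /(Zplus_inj Zx').
- exact/neighboursC.
- apply/ffunP => l; rewrite e !ffunE; by have [->|//] := eqVneq l j.
Qed.

Lemma label_up_weight (R : realType) (q : R) (d : nat) z (x x' : {ffun 'I_d -> nat}) :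
  label_up z x x' -> label_weight q x' = q * label_weight q x.
Proof.
move=> [j [_ _ ->]]; rewrite /label_weight -exprS (bigD1 j)//= ffunE eqxx.
rewrite [in RHS](bigD1 j)//= addSn; congr (_ ^+ (_ + _).+1).
by apply: eq_bigr => l lj; rewrite ffunE (negbTE lj).
Qed.

(** A right jump and its reverse have rates [1] and [q], an upward label move and its reverse [q]
    and [1]; [mu] and [label_weight] carry exactly the compensating ratios. *)
Lemma coupled_detailed_balance (R : realType) (q : R) (d : nat) (mu : Omega -> R) :
  (forall z z' : Omega, right_jump (val z) (val z') -> mu z = q * mu z') ->
  forall a b : coupled_state d,
  coupled_weight q mu a * coupled_rate q a b =
  coupled_weight q mu b * coupled_rate q b a.
Proof.
move=> hmu [z x] [z' x']; rewrite /coupled_weight /coupled_rate /=.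
have hR (w w' : Omega) :
    mu w * (`[< right_jump (val w) (val w') >])%:R =
    mu w' * (q * (`[< right_jump (val w) (val w') >])%:R).
  by case: asboolP => [/hmu->|_]; rewrite /= ?mulr0// !mulr1 mulrC.
have hU (w : Omega) (y y' : Zplus d) :
    label_weight q (val y) * (q * (`[< label_up (val w) (val y) (val y') >])%:R) =
    label_weight q (val y') * (`[< label_up (val w) (val y) (val y') >])%:R.
  by case: asboolP => [/(label_up_weight q)->|_]; rewrite /= ?mulr0// !mulr1 mulrC.
rewrite [LHS]mulrDr [RHS]mulrDr; congr (_ + _).
  rewrite [x == x']eq_sym; have [->|_] := eqVneq x' x; last by rewrite !mul0r !mulr0.
  rewrite !mul1r -!mulrA [RHS]mulrCA [LHS]mulrCA; congr (_ * _).
  rewrite /asep_rate !(asbool_equiv_eq (left_jump_right _ _)) !mulrDr.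
  by rewrite (hR z z') (hR z' z) addrC.
rewrite [z == z']eq_sym; have [->|_] := eqVneq z' z; last by rewrite !mul0r !mulr0.
rewrite !mul1r -!mulrA; congr (_ * _); rewrite /label_rate !mulrDr.
rewrite !(asbool_equiv_eq (label_down_up _ _ _)); try exact: set_typeP.
by rewrite !hU addrC.
Qed.

(** * Finiteness of the total flow *)

Lemma esum_unique_le (R : realType) (I : choiceType) (Q : I -> Prop) (k : R) :
  0 <= k -> (forall i j, Q i -> Q j -> i = j) ->
  (\esum_(i in [set: I]) (k * (`[< Q i >])%:R)%:E <= k%:E)%E.
Proof.
move=> k0 Qinj; have [[i Qi]|nQ] := pselect (exists i, Q i).
  rewrite -[leRHS](@esum_mkpoint _ _ i (fun=> k%:E)) ?lee_fin//.
  apply: le_esum => j _; case: asboolP => [/Qinj/(_ Qi)->|_].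
    by rewrite eqxx mulr1.
  by rewrite mulr0; case: ifP; rewrite ?lee_fin.
rewrite esum1 ?lee_fin// => i _.
by rewrite asboolF ?mulr0// => Qi; apply: nQ; exists i.
Qed.

Section exit_rates.
Context {R : realType} {d : nat}.
Variable q : R.
Hypothesis q_gt0 : 0 < q.

Let q_ge0 : 0 <= q. Proof. exact: ltW. Qed.

(** Number of bonds across which a jump is possible, in one direction or the other. It is finite for
    each configuration of [Omega] but has no uniform bound, so it is controlled in mean. *)
Definition interfaces (z : config) : \bar R :=
  (\esum_(i in [set: int]) ((z i != z (i + 1))%:R)%:E)%E.

Lemma asep_exit_le (z : Omega) :
  (\esum_(z' in [set: Omega]) (asep_rate q (val z) (val z'))%:E <=
   (1 + q)%:E * interfaces (val z))%E.
Proof.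
have q1 : 0 <= 1 + q by rewrite addr_ge0.
pose g (z' : Omega) (i : int) : R :=
  (1 + q) * (val z i != val z (i + 1))%:R * (`[< val z' = exchange (val z) i >])%:R.
have g0 z' i : 0 <= g z' i by rewrite !mulr_ge0.
have jump_le z' i : val z i != val z (i + 1) -> val z' = exchange (val z) i ->
    (asep_rate q (val z) (val z') <= g z' i).
  move=> zi ez; rewrite /g zi (asboolT ez) !mulr1 lerD//; first by case: asbool.
  by rewrite -[leRHS]mulr1 ler_wpM2l//; case: asbool.
apply: (@le_trans _ _ (\esum_(z' in [set: Omega])
   \esum_(i in [set: int]) (g z' i)%:E)%E).
  apply: le_esum => z' _.
  have [[i [zi ez]]|nj] := pselect (exists i,
      val z i != val z (i + 1) /\ val z' = exchange (val z) i).
    apply: (@le_trans _ _ (g z' i)%:E); first by rewrite lee_fin jump_le.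
    by apply: (esum_ge_term (f := fun i => (g z' i)%:E)) => //; rewrite lee_fin.
  rewrite /asep_rate !asboolF ?mulr0 ?addr0; first last.
  - move=> [i [zi zi1 ez]]; apply: nj; exists i; split=> //.
    by rewrite zi; exact: contraNneq zi1 => <-.
  - move=> [i [zi zi1 ez]]; apply: nj; exists i; split=> //.
    by rewrite zi; exact: contraNneq zi1 => ->.
  by apply: esum_ge0 => i _; rewrite lee_fin.
rewrite esum_exchange; last by move=> z' i; rewrite lee_fin.
rewrite -ge0_esumZl//; apply: le_esum => i _; rewrite -EFinM.
apply: esum_unique_le => [|w w' ew ew']; first by rewrite mulr_ge0.
by apply: val_inj; rewrite ew ew'.
Qed.

Lemma label_exit_le (z : config) (x : Zplus d) :
  (\esum_(x' in [set: Zplus d]) (label_rate q z (val x) (val x'))%:E <=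
   (d%:R * (1 + q))%:E)%E.
Proof.
pose g (x' : Zplus d) (j : 'I_d) : \bar R :=
  ((q * (`[< val x' = set_label (val x) j (val x j).+1 >])%:R)%:E +
   (1 * (`[< val x' = set_label (val x) j (val x j).-1 >])%:R)%:E)%E.
have g0 x' j : (0 <= g x' j)%E by rewrite adde_ge0// lee_fin mulr_ge0.
apply: (@le_trans _ _ (\esum_(x' in [set: Zplus d]) \sum_(j < d) g x' j)%E).
  apply: le_esum => x' _; rewrite big_split/= EFinD.
  apply: leeD.
    case: asboolP => [[j [_ _ e]]|_]; last first.
      by rewrite mulr0 sume_ge0// => j _; rewrite lee_fin mulr_ge0.
    rewrite (bigD1 j)//= (asboolT e) leeDl// sume_ge0// => l _.
    by rewrite lee_fin mulr_ge0.
  case: asboolP => [[j [_ _ _ e]]|_]; last first.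
    by rewrite sume_ge0// => j _; rewrite lee_fin mulr_ge0.
  rewrite (bigD1 j)//= (asboolT e) mulr1 leeDl// sume_ge0//.
rewrite esum_sum//.
apply: (@le_trans _ _ (\sum_(j < d) (1 + q)%:E)%E); last first.
  by rewrite sumEFin lee_fin sumr_const card_ord mulr_natl.
apply: lee_sum => j _; rewrite esumD; last 2 first.
- by move=> x' _; rewrite lee_fin mulr_ge0.
- by move=> x' _; rewrite lee_fin mulr_ge0.
rewrite addeC EFinD; apply: leeD.
  by apply: esum_unique_le => // y y' ey ey'; apply: val_inj; rewrite ey ey'.
by apply: esum_unique_le => // y y' ey ey'; apply: val_inj; rewrite ey ey'.
Qed.

Lemma coupled_exit_le (a : coupled_state d) :
  (\esum_(b in [set: coupled_state d]) (coupled_rate q a b)%:E <=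
   (1 + q)%:E * (interfaces (val a.1) + d%:R%:E))%E.
Proof.
case: a => z x.
have i0 : (0 <= interfaces (val z))%E by apply: esum_ge0 => i _; rewrite lee_fin.
rewrite ge0_muleDr ?lee_fin// -EFinM [(_ * d%:R)%R]mulrC.
apply: le_trans (leeD (asep_exit_le z) (label_exit_le (val z) x)).
have a0 z' : (0 <= (asep_rate q (val z) (val z'))%:E)%E.
  by rewrite lee_fin asep_rate_ge0.
have l0 (x' : Zplus d) : (0 <= (label_rate q (val z) (val x) (val x'))%:E)%E.
  by rewrite lee_fin label_rate_ge0.
rewrite esum_pair; last by move=> k; rewrite lee_fin coupled_rate_ge0.
pose A (z' : Omega) (x' : Zplus d) : \bar R :=
  if x' == x then (asep_rate q (val z) (val z'))%:E else 0%E.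
pose B (z' : Omega) (x' : Zplus d) : \bar R :=
  if z' == z then (label_rate q (val z) (val x) (val x'))%:E else 0%E.
have A0 z' x' : (0 <= A z' x')%E by rewrite /A; case: ifP.
have B0 z' x' : (0 <= B z' x')%E by rewrite /B; case: ifP.
rewrite (_ : (\esum_(i in _) _)%E =
    (\esum_(z' in [set: Omega]) \esum_(x' in [set: Zplus d]) A z' x' +
     \esum_(z' in [set: Omega]) \esum_(x' in [set: Zplus d]) B z' x')%E).
  rewrite [X in (_ + X)%E]esum_exchange//; apply: leeD.
    apply: le_esum => z' _.
    by rewrite /A (@esum_mkpoint _ _ x (fun=> (asep_rate q (val z) (val z'))%:E)).
  apply: le_esum => x' _; rewrite /B.
  by rewrite (@esum_mkpoint _ _ z (fun=> (label_rate q (val z) (val x) (val x'))%:E)).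
rewrite -esumD; last 2 first.
- by move=> z' _; exact: esum_ge0.
- by move=> z' _; exact: esum_ge0.
apply: eq_esum => z' _; rewrite -esumD//.
apply: eq_esum => x' _; rewrite /coupled_rate /A /B /= EFinD.
by case: (x' == x); case: (z' == z); rewrite ?mul1r ?mul0r.
Qed.

(** The bound on the exit rates depends on the configuration only, so the total flow is at most the
    product of the label partition function and a [mu]-mean. *)
Lemma coupled_flow_finite (mu : Omega -> R) : q < 1 -> (forall z, 0 <= mu z) ->
  (\esum_(z in [set: Omega]) (mu z)%:E < +oo)%E ->
  (\esum_(z in [set: Omega]) ((mu z)%:E * interfaces (val z)) < +oo)%E ->
  (\esum_(a in [set: coupled_state d]) \esum_(b in [set: coupled_state d])
     (coupled_weight q mu a * coupled_rate q a b)%:E < +oo)%E.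
Proof.
move=> q_lt1 mu0 mufin intfin.
have i0 z : (0 <= interfaces z)%E by apply: esum_ge0 => i _; rewrite lee_fin.
have w0 (x : {ffun 'I_d -> nat}) : 0 <= label_weight q x by rewrite exprn_ge0.
pose h (z : Omega) : \bar R :=
  ((mu z)%:E * ((1 + q)%:E * (interfaces (val z) + d%:R%:E)))%E.
have h0 z : (0 <= h z)%E.
  by rewrite !mule_ge0 ?lee_fin// ?addr_ge0// adde_ge0.
apply: (@le_lt_trans _ _ (\esum_(a in [set: coupled_state d])
    ((label_weight q (val a.2))%:E * h a.1))%E).
  apply: le_esum => a _.
  under eq_esum do rewrite EFinM.
  rewrite ge0_esumZl ?mulr_ge0//; last by move=> b; rewrite lee_fin coupled_rate_ge0.
  rewrite /coupled_weight mulrC EFinM -muleA lee_wpmul2l ?lee_fin//.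
  by rewrite lee_wpmul2l ?lee_fin// coupled_exit_le.
rewrite esum_pair; last by move=> a; rewrite mule_ge0 ?lee_fin.
rewrite esum_exchange; last by move=> z x; rewrite mule_ge0 ?lee_fin.
have hfin : (\esum_(z in [set: Omega]) h z < +oo)%E.
  rewrite /h (_ : (\esum_(z in _) _)%E = ((1 + q)%:E *
     (\esum_(z in [set: Omega]) ((mu z)%:E * interfaces (val z)) +
      d%:R%:E * \esum_(z in [set: Omega]) (mu z)%:E))%E).
    rewrite lte_mul_pinfty ?lee_fin ?addr_ge0// lte_add_pinfty//.
    by rewrite lte_mul_pinfty.
  rewrite -ge0_esumZl// -?esumD; last 2 first.
  - by move=> z _; rewrite mule_ge0// lee_fin.
  - by move=> z _; rewrite mule_ge0// lee_fin.
  rewrite -ge0_esumZl ?addr_ge0//; last first.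
    by move=> z; rewrite adde_ge0// mule_ge0// lee_fin.
  apply: eq_esum => z _; rewrite muleCA; congr (_ * _)%E.
  by rewrite ge0_muleDr// [X in (_ + X)%E]muleC.
have hge0 : (0 <= \esum_(z in [set: Omega]) h z)%E by apply: esum_ge0.
rewrite (eq_esum (b := fun x : Zplus d =>
    ((fine (\esum_(z in [set: Omega]) h z))%:E * (label_weight q (val x))%:E)%E)).
  rewrite ge0_esumZl ?fine_ge0//; last by move=> x; rewrite lee_fin.
  rewrite (esum_set_typeT (Zplus d) (fun x => (label_weight q x)%:E)).
  by rewrite label_weight_esum// -EFinM ltry.
by move=> x _; rewrite /= ge0_esumZl// muleC fineK// ge0_fin_numE.
Qed.

End exit_rates.

(** * The product measure *)

Lemma countable_inj_countType (X : Type) (C : countType) (f : X -> C) :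
  injective f -> countable [set: X].
Proof.
move=> finj; apply/countable_injP; exists (choice.pickle \o f) => x y _ _.
by move=> /(pcan_inj (@choice.pickleK C))/finj.
Qed.

(** A configuration of [Omega] is determined by two finite sets: its particles in [i <= 0] and its
    holes in [i >= 1]. *)
Lemma countable_Omega : countable [set: Omega].
Proof.
pose f (z : Omega) : {fset int} * {fset int} :=
  (fset_set [set i | i <= 0 /\ val z i], fset_set [set i | 1 <= i /\ ~~ val z i]).
apply: (@countable_inj_countType _ _ f) => z z' [e1 e2].
apply: val_inj; apply/funext => i.
have [l r] := set_typeP z; have [l' r'] := set_typeP z'.
have [i0|i0] := leP i 0.
  apply/idP/idP => zi.
    have : i \in fset_set [set i | i <= 0 /\ val z i] by rewrite in_fset_set// inE.
    by rewrite e1 in_fset_set// inE => -[].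
  have : i \in fset_set [set i | i <= 0 /\ val z' i] by rewrite in_fset_set// inE.
  by rewrite -e1 in_fset_set// inE => -[].
apply: negb_inj; apply/idP/idP => zi.
  have : i \in fset_set [set i | 1 <= i /\ ~~ val z i] by rewrite in_fset_set// inE.
  by rewrite e2 in_fset_set// inE => -[].
have : i \in fset_set [set i | 1 <= i /\ ~~ val z' i] by rewrite in_fset_set// inE.
by rewrite -e2 in_fset_set// inE => -[].
Qed.

Lemma countable_coupled_state d : countable [set: coupled_state d].
Proof.
rewrite -setXTT; apply: countableX; first exact: countable_Omega.
exact: (@countable_inj_countType _ _ val val_inj).
Qed.

Definition int_itv (a : int) (n : nat) : {fset int} :=
  [fset (a + (nat_of_ord k)%:Z)%R | k in 'I_n]%fset.

Lemma mem_int_itv a n i : (i \in int_itv a n) = (a <= i < a + n%:Z).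
Proof.
apply/imfsetP/idP => [[k _ ->]|/andP[ai ia]]; first by have := ltn_ord k; lia.
have kn : (absz (i - a)%R < n)%N by lia.
by exists (Ordinal kn) => //=; lia.
Qed.

Lemma big_int_itv (V : Type) (idx : V) (op : Monoid.com_law idx) a n (F : int -> V) :
  \big[op/idx]_(i <- int_itv a n) F i = \big[op/idx]_(k < n) F (a + k%:Z).
Proof.
rewrite big_imfset/=; first by rewrite big_enum.
by move=> k l _ _ /= kl; apply: val_inj => /=; lia.
Qed.

Section mu_density.
Context {R : realType}.
Variables q c : R.
Hypothesis q_gt0 : 0 < q.

Lemma mu_densityC i : 1 - mu_density q c i = (1 + q `^ (c - i%:~R))^-1.
Proof.
have := powR_gt0 (c - i%:~R) q_gt0; rewrite /mu_density; set x := q `^ _ => x0.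
by field; rewrite gt_eqF// addr_gt0.
Qed.

Lemma mu_density_le i : mu_density q c i <= q `^ (c - i%:~R).
Proof.
have := powR_gt0 (c - i%:~R) q_gt0; rewrite /mu_density; set x := q `^ _ => x0.
by rewrite ler_pdivrMr ?addr_gt0//; nra.
Qed.

Lemma mu_densityC_le i : 1 - mu_density q c i <= q `^ (i%:~R - c).
Proof.
rewrite mu_densityC -[i%:~R - c]opprB powRN; have := powR_gt0 (c - i%:~R) q_gt0.
by move=> x0; rewrite lef_pV2 ?posrE ?addr_gt0// lerDr.
Qed.

(** The odds of a particle at [i] are [q ^ (c - i)], that is [q] times the odds at [i + 1]. *)
Lemma mu_density_exchange i :
  mu_density q c i * (1 - mu_density q c (i + 1)) =
  q * (mu_density q c (i + 1) * (1 - mu_density q c i)).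
Proof.
rewrite !mu_densityC /mu_density.
have -> : q `^ (c - i%:~R) = q * q `^ (c - (i + 1)%:~R).
  rewrite -[X in X * _]powRr1 ?ltW// -powRD; last by apply/implyP => _; rewrite gt_eqF.
  by congr (_ `^ _); rewrite intrD; ring.
ring.
Qed.

End mu_density.

Section stationary_measure.
Context {R : realType} {dT : measure_display} {T : measurableType dT}.
Variables (P : probability T R) (q c : R) (xi : T -> Omega).
Hypothesis mxi : forall B : set Omega, measurable (xi @^-1` B).
Hypothesis xi_law : mu_law P q c (fun w => val (xi w)).

Notation mu := (mass P xi).
Notation rho := (mu_density q c).

Lemma law_mu (B : set Omega) : P (xi @^-1` B) = (\esum_(z in B) (mu z)%:E)%E.
Proof. by apply: law_esum => //; exact: countable_Omega. Qed.

Lemma mu_total : (\esum_(z in [set: Omega]) (mu z)%:E = 1)%E.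
Proof. by rewrite -law_mu preimage_setT probability_setT. Qed.

Lemma mu_event (Q : Omega -> bool) :
  (\esum_(z in [set: Omega]) (mu z * (Q z)%:R)%:E = P [set w | Q (xi w)])%E.
Proof.
have /= -> := law_mu [set z | Q z]; rewrite [RHS]esum_mkcond; apply: eq_esum => z _.
have -> : (z \in [set z | Q z]) = Q z by apply/idP/idP; rewrite inE.
by case: (Q z); rewrite ?mulr1 ?mulr0.
Qed.

Lemma mu_cylinder a n (b : int -> bool) :
  P [set w | forall i, a <= i < a + n%:Z -> val (xi w) i = b i] =
  (\prod_(i <- int_itv a n) (if b i then rho i else 1 - rho i))%:E.
Proof.
rewrite -xi_law; congr (P _); apply/seteqP; split=> w /= h i.
  by rewrite mem_int_itv => /h.
by rewrite -mem_int_itv => /h.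
Qed.

Lemma mu_coord i (b : bool) :
  P [set w | val (xi w) i == b] = (if b then rho i else 1 - rho i)%:E.
Proof.
have := mu_cylinder i 1 (fun=> b); rewrite big_int_itv big_ord1 addr0 => <-.
congr (P _); apply/seteqP; split=> w /= => [/eqP e j|]; last by move=> ->//; lia.
by move=> ij; rewrite -e; congr (val (xi w) _); lia.
Qed.

(** Independence, for a product of functions of single sites: both sides are expanded over the
    patterns [b] of the window, whose probabilities are given by [mu_cylinder]. *)
Lemma mu_product a n (f : 'I_n -> bool -> R) : (forall k b, 0 <= f k b) ->
  (\esum_(z in [set: Omega]) (mu z * \prod_(k < n) f k (val z (a + k%:Z)))%:E =
   (\prod_(k < n) (f k true * rho (a + k%:Z) +
                   f k false * (1 - rho (a + k%:Z))))%:E)%E.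
Proof.
move=> f0.
pose agree (z : Omega) (b : {ffun 'I_n -> bool}) :=
  [forall k : 'I_n, val z (a + k%:Z) == b k].
have expand (z : Omega) : (mu z * \prod_(k < n) f k (val z (a + k%:Z)))%:E =
    (\sum_(b : {ffun 'I_n -> bool})
       (\prod_(k < n) f k (b k))%:E * (mu z * (agree z b)%:R)%:E)%E.
  rewrite (bigD1 [ffun k : 'I_n => val z (a + k%:Z)])//= [X in (_ + X)%E]big1 ?adde0.
    rewrite (_ : agree _ _) ?mulr1; last by apply/forallP => k; rewrite ffunE.
    rewrite -EFinM mulrC; congr EFin; congr (_ * _).
    by apply: eq_bigr => k _; rewrite ffunE.
  move=> b zb; rewrite (_ : agree z b = false) ?mulr0 ?mule0//.
  apply: contraNF zb => /forallP ab; apply/eqP/ffunP => k.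
  by rewrite ffunE; apply/esym/eqP; exact: ab.
rewrite (eq_esum (fun z _ => expand z)) esum_sum; last first.
  move=> z b _ _; rewrite mule_ge0// lee_fin ?prodr_ge0// mulr_ge0//.
  exact: mass_ge0.
have -> : \prod_(k < n) (f k true * rho (a + k%:Z) +
      f k false * (1 - rho (a + k%:Z))) =
    \prod_(k < n) \sum_(b : bool)
      f k b * (if b then rho (a + k%:Z) else 1 - rho (a + k%:Z)).
  by apply: eq_bigr => k _; rewrite big_bool.
rewrite bigA_distr_bigA/= -sumEFin; apply: eq_bigr => b _.
rewrite ge0_esumZl ?prodr_ge0//; last first.
  by move=> z; rewrite lee_fin mulr_ge0// mass_ge0.
rewrite mu_event big_split/= EFinM; congr (_ * _)%E.
(* [mu_cylinder] takes a pattern on all of the integers; the value [false] outside the window is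
   never read. *)
pose b' (i : int) := if insub (absz (i - a)%R) is Some k then b k else false.
have b'E (k : 'I_n) : b' (a + k%:Z) = b k.
  rewrite /b' (_ : absz _ = k :> nat) ?valK//; lia.
transitivity (\prod_(k < n) (if b' (a + k%:Z) then rho (a + k%:Z)
                              else 1 - rho (a + k%:Z)))%:E; last first.
  by congr EFin; apply: eq_bigr => k _; rewrite b'E.
rewrite -(big_int_itv _ a n (fun i => if b' i then rho i else 1 - rho i)).
rewrite -mu_cylinder; congr (P _); apply/seteqP; split=> w /=.
  move=> /forallP zb i /andP[ai ia].
  have kn : (absz (i - a)%R < n)%N by lia.
  have -> : i = a + (Ordinal kn : nat)%:Z by move=> /=; lia.
  by rewrite b'E; apply/eqP; exact: zb.
move=> zb; apply/forallP => k; apply/eqP.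
by rewrite -b'E; apply: zb; have := ltn_ord k; lia.
Qed.

(** Continuity from above along the windows [[-n, n]], of [2 n + 1] sites. *)
Lemma mu_cylinder_cvg (z : Omega) :
  P [set w | forall i, - n%:Z <= i < - n%:Z + (n + n).+1%:Z -> val (xi w) i = val z i]
    @[n --> \oo] --> (mu z)%:E.
Proof.
pose A (n : nat) := xi @^-1` [set y : Omega |
  forall i, - n%:Z <= i < - n%:Z + (n + n).+1%:Z -> val y i = val z i].
rewrite massE// (_ : xi @^-1` [set z] = \bigcap_n A n).
  apply: (@nonincreasing_cvg_mu _ _ _ P A).
  - by rewrite -ge0_fin_numE// fin_num_measure//; exact: mxi.
  - by move=> n; exact: mxi.
  - rewrite (_ : \bigcap_n A n =
      xi @^-1` (\bigcap_n [set y : Omega |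
       forall i, - n%:Z <= i < - n%:Z + (n + n).+1%:Z -> val y i = val z i]))//.
  - move=> m n mn; apply/subsetPset => w /= h i hi; apply: h; lia.
apply/seteqP; split=> [w /= e n _ i _ /=|w h]; first by rewrite e.
apply: val_inj; apply/funext => i.
by apply: (h (absz i) I); lia.
Qed.

Hypothesis q_gt0 : 0 < q.

(** As soon as the window contains [i] and [i + 1], the cylinder probabilities of [z] and [z']
    differ by these two factors only and have ratio [q]; the relation passes to the limit. *)
Lemma mu_right_jump (z z' : Omega) :
  right_jump (val z) (val z') -> mu z = q * mu z'.
Proof.
move=> [i [zi zi1 ez]].
have ezi : val z' i = false by rewrite ez /exchange eqxx; exact: negbTE.
have ezi1 : val z' (i + 1) = true.
  by rewrite ez /exchange eqxx; case: eqVneq => //; lia.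
have lim := @mu_cylinder_cvg z; have lim' := @mu_cylinder_cvg z'.
suff : (mu z)%:E = (q * mu z')%:E by move=> [].
apply: (cvg_unique _ lim) => //; rewrite EFinM.
apply: cvg_trans (cvgeZl _ lim') => //; apply: near_eq_cvg.
near=> n.
have ni : (absz i + 2 <= n)%N by near: n; exact: nbhs_infty_ge.
rewrite !mu_cylinder -EFinM; congr EFin.
have iF : i \in int_itv (- n%:Z) (n + n).+1 by rewrite mem_int_itv; lia.
have i1F : i + 1 \in (int_itv (- n%:Z) (n + n).+1 `\ i)%fset.
  by rewrite in_fsetD1 mem_int_itv; lia.
rewrite !(big_fsetD1 _ iF)/= !(big_fsetD1 _ i1F)/=.
rewrite ezi ezi1 zi (negbTE zi1).
rewrite (eq_big_seq (fun j => if val z j then rho j else 1 - rho j)); last first.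
  move=> j; rewrite !in_fsetD1 => /and3P[j1 ji _].
  by rewrite ez /exchange (negbTE ji) (negbTE j1).
have := mu_density_exchange c q_gt0 i; rewrite /=.
move: (rho i) (rho (i + 1)) (\prod_(_ <- _) _) => r r1 p e.
by rewrite [RHS]mulrA e; ring.
Unshelve. all: by end_near. Qed.

End stationary_measure.

(** * The stationary law *)

Lemma esum_int_le (R : realType) (q k : R) (f : int -> \bar R) :
  0 <= q -> q < 1 -> 0 <= k -> (forall i, 0 <= f i)%E ->
  (forall n : nat, f (Posz n) <= (k * q ^+ n)%:E)%E ->
  (forall n : nat, f (Negz n) <= (k * q ^+ n)%:E)%E ->
  (\esum_(i in [set: int]) f i < +oo)%E.
Proof.
move=> q0 q1 k0 f0 fp fn.
have geo (e : nat -> int) : injective e -> (forall n, f (e n) <= (k * q ^+ n)%:E)%E ->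
    (\esum_(i in range e) f i < +oo)%E.
  move=> einj fe; rewrite esum_image; last by move=> x y _ _ /einj.
  apply: (@le_lt_trans _ _ (\esum_(n in [set: nat]) (k%:E * (q ^+ n)%:E))%E).
    exact: le_esum.
  rewrite ge0_esumZl//; last by move=> n; rewrite lee_fin exprn_ge0.
  by rewrite esum_geometric// -EFinM ltry.
rewrite (esumID (range Posz))// !setTI lte_add_pinfty//.
  by apply: geo => // x y [].
rewrite (_ : ~` range Posz = range Negz); first by apply: geo => // x y [].
apply/seteqP; split=> [[n|n] /= h|_ [n _ <-] [m _]//].
- by exfalso; apply: h; exists n.
- by exists n.
Qed.

Section interface_density.
Context {R : realType} {dT : measure_display} {T : measurableType dT}.
Variables (P : probability T R) (q c : R) (xi : T -> Omega).
Hypotheses (q_gt0 : 0 < q) (q_lt1 : q < 1).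
Hypothesis mxi : forall B : set Omega, measurable (xi @^-1` B).
Hypothesis xi_law : mu_law P q c (fun w => val (xi w)).

Notation mu := (mass P xi).
Notation rho := (mu_density q c).

(** Of two different neighbouring values one equals [b]. Below, [b] is the rare value: [false] on
    the right, [true] on the left. *)
Lemma interface_le (b : bool) i : 
  (P [set w | val (xi w) i != val (xi w) (i + 1)%R] <=
   (if b then rho i else 1 - rho i)%:E +
   (if b then rho (i + 1) else 1 - rho (i + 1))%:E)%E.
Proof.
have mE (Q : Omega -> bool) : measurable [set w | Q (xi w)].
  exact: (mxi [set z | Q z]).
rewrite -!(mu_coord xi_law).
apply: le_trans (measureU2 _ (mE (fun z => val z i == b))
  (mE (fun z => val z (i + 1) == b))).
apply: le_measure; rewrite ?inE.
- exact: (mE (fun z => val z i != val z (i + 1))).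
- by apply: measurableU; [exact: (mE (fun z => val z i == b))
    | exact: (mE (fun z => val z (i + 1) == b))].
by move=> w /=; case: b; case: (sval _ i); case: (sval _ (i + 1)) => //;
  [left|right|right|left].
Qed.

Lemma interfaces_finite :
  (\esum_(z in [set: Omega]) ((mu z)%:E * interfaces (val z)) < +oo)%E.
Proof.
rewrite (eq_esum (b := fun z => \esum_(i in [set: int])
    (mu z * (val z i != val z (i + 1)%R)%:R)%:E)%E); last first.
  by move=> z _; rewrite -ge0_esumZl ?mass_ge0.
rewrite esum_exchange; last first.
  by move=> z i; rewrite lee_fin mulr_ge0 ?mass_ge0.
have powS r (n : nat) : q `^ (r + n%:R) = q `^ r * q ^+ n.
  by rewrite powRD ?powR_mulrn ?ltW//; apply/implyP => _; rewrite gt_eqF.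
(* The two summands serve the two half lines: [q ^ (n - c) + q ^ (n + 1 - c)] bounds the term at
   [n], and [q ^ (c + n + 1) + q ^ (c + n)] the term at [- n - 1]. *)
apply: (@esum_int_le _ q (q `^ (- c) * (1 + q) + q `^ c * (1 + q))) => //.
- exact: ltW.
- by rewrite addr_ge0// mulr_ge0 ?powR_ge0 ?addr_ge0// ltW.
- by move=> i; apply: esum_ge0 => z _; rewrite lee_fin mulr_ge0 ?mass_ge0.
- move=> n; rewrite (mu_event P mxi (fun z => val z (Posz n) != val z (Posz n + 1))).
  apply: le_trans (interface_le false _) _; rewrite -EFinD lee_fin.
  apply: le_trans (lerD (mu_densityC_le c q_gt0 _) (mu_densityC_le c q_gt0 _)) _.
  have -> : (Posz n)%:~R - c = - c + n%:R by rewrite addrC.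
  have -> : (Posz n + 1)%:~R - c = - c + n.+1%:R by rewrite addrC -natr1 intrD.
  rewrite !powS exprS.
  rewrite [leRHS]mulrDl [leLHS](_ : _ = q `^ (- c) * (1 + q) * q ^+ n); last ring.
  by rewrite lerDl !mulr_ge0 ?powR_ge0 ?exprn_ge0 ?addr_ge0// ltW.
- move=> n; rewrite (mu_event P mxi (fun z => val z (Negz n) != val z (Negz n + 1))).
  apply: le_trans (interface_le true _) _; rewrite -EFinD lee_fin.
  apply: le_trans (lerD (mu_density_le c q_gt0 _) (mu_density_le c q_gt0 _)) _.
  rewrite (_ : Negz n + 1 = - n%:Z); last by rewrite NegzE; lia.
  rewrite NegzE !intrN !opprK !powS exprS.
  rewrite [leRHS]mulrDl [leLHS](_ : _ = q `^ (c) * (1 + q) * q ^+ n); last ring.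
  by rewrite lerDr !mulr_ge0 ?powR_ge0 ?exprn_ge0 ?addr_ge0// ltW.
Qed.

End interface_density.

Lemma coupled_rate_diag (R : realType) (d : nat) (q : R) (a : coupled_state d) :
  coupled_rate q a a = 0.
Proof.
have njump z : ~ right_jump z z by move=> /right_jump_neq; rewrite eqxx.
have nup (x : Zplus d) z : ~ label_up z (val x) (val x).
  by move=> [j [xj _]] /(congr1 (fun f : {ffun _ -> nat} => f j)) /eqP;
  rewrite ffunE eqxx ltn_eqF.
rewrite /coupled_rate !eqxx !mul1r /asep_rate /label_rate.
rewrite (asboolF (@njump _)) (asboolF (@nup _ _)) asboolF ?asboolF ?mulr0 ?addr0//.
  by rewrite label_down_up; [exact: nup|exact: set_typeP|exact: set_typeP].
by rewrite left_jump_right; exact: njump.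
Qed.

Section stationary_coupled.
Context {R : realType} {dT : measure_display} {T : measurableType dT}.
Variables (P : probability T R) (q c : R) (d : nat) (Z : R -> T -> coupled_state d).
Hypotheses (q_gt0 : 0 < q) (q_lt1 : q < 1).
Hypothesis Z_process : markov_jump_process P (coupled_rate q) Z.
Hypothesis Z_stationary : stationary P Z.
Hypothesis xi_law : mu_law P q c (fun w => val (Z 0 w).1).

Let xi w := (Z 0 w).1.
Notation mu := (mass P xi).
Notation pi := (mass P (Z 0)).

Let mZ (B : set (coupled_state d)) : measurable (Z 0 @^-1` B).
Proof. by case: Z_process => mZ _ _; exact: mZ. Qed.

Let mxi (B : set Omega) : measurable (xi @^-1` B).
Proof. exact: (mZ [set a | B a.1]). Qed.

Lemma stationary_marginal z :
  (\esum_(x in [set: Zplus d]) (pi (z, x))%:E = (mu z)%:E)%E.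
Proof.
rewrite (massE P mxi) -[xi @^-1` _]/(Z 0 @^-1` [set a | a.1 = z]).
rewrite (law_esum P mZ (countable_coupled_state d)) [RHS]esum_mkcond.
rewrite esum_pair; last first.
  by move=> k; case: ifP => // _; rewrite lee_fin mass_ge0.
rewrite -(@esum_mkpoint _ _ z (fun z => \esum_(x in [set: Zplus d]) (pi (z, x))%:E)%E).
  apply: eq_esum => z' _; case: eqVneq => [->|zz'].
    by apply: eq_esum => x _; rewrite mem_set.
  by rewrite esum1// => x _; rewrite memNset//= => /eqP; exact/negP.
by apply: esum_ge0 => x _; rewrite lee_fin mass_ge0.
Qed.

Lemma stationary_product (a : coupled_state d) :
  pi a = coupled_weight q mu a / label_partition d q.
Proof.
have q_ge0 := ltW q_gt0.
have mu0 z : 0 <= mu z by exact: mass_ge0.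
have pi0 b : 0 <= pi b by exact: mass_ge0.
have w_gt0 (x : {ffun 'I_d -> nat}) : 0 < label_weight q x by rewrite exprn_gt0.
set m := coupled_weight q mu.
have m0 b : 0 <= m b by rewrite mulr_ge0// ltW.
have r0 (b b' : coupled_state d) : 0 <= coupled_rate q b b' by exact: coupled_rate_ge0.
(* Where [m] vanishes, the quotient is [0] by convention and [pi] vanishes too, being at most its
   marginal [mu]; thus [m * u = pi] holds everywhere. *)
pose u b := pi b / m b.
have mu_eq0 b : m b = 0 -> mu b.1 = 0.
  by move/eqP; rewrite mulf_eq0 (gt_eqF (w_gt0 _)) orbF => /eqP.
have m_eq0 b : m b = 0 -> pi b = 0.
  case: b => z x /mu_eq0 /= muz; apply/eqP; rewrite eq_le pi0 andbT -lee_fin.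
  apply: (@le_trans _ _ (mu z)%:E); last by rewrite muz.
  rewrite -stationary_marginal.
  by apply: (esum_ge_term (f := fun x => (pi (z, x))%:E)); rewrite ?lee_fin.
have muE b : m b * u b = pi b.
  have [mb|mb] := eqVneq (m b) 0; first by rewrite mb mul0r (m_eq0 _ mb).
  by rewrite mulrC divfK.
have bal b b' : m b * coupled_rate q b b' = m b' * coupled_rate q b' b.
  exact: coupled_detailed_balance (mu_right_jump mxi xi_law q_gt0) _ _.
have u_edge b b' : 0 < m b * coupled_rate q b b' -> u b = u b'.
  apply: (@superharmonic_const _ _
    (fun b b' => m b * coupled_rate q b b') u) => //.
  - by move=> e e'; rewrite mulr_ge0.
  - by move=> e; rewrite divr_ge0.
  - apply: coupled_flow_finite => //; first by rewrite mu_total// ltry.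
    exact: (interfaces_finite q_gt0 q_lt1 mxi xi_law).
  (* By detailed balance the inflow [pi e' * r e' e] equals [m e * r e e' * u e'], so the flow
     inequality is superharmonicity of [u] at [e]. The diagonal terms added to both sums are
     zero. *)
  move=> e; have := stationary_flow_le Z_process Z_stationary e.
  rewrite -ge0_esumZl//; last by move=> e'; rewrite lee_fin.
  rewrite esum_mkcond [X in (_ <= X)%E -> _]esum_mkcond.
  congr (_ <= _)%E; apply: eq_esum => e' _.
    have [->|e'e] := eqVneq e' e.
      by rewrite memNset ?coupled_rate_diag ?mulr0 ?mul0r//= eqxx.
    by rewrite mem_set// bal mulrAC muE.
  have [->|e'e] := eqVneq e' e.
      by rewrite memNset ?coupled_rate_diag ?mulr0 ?mul0r//= eqxx.
  by rewrite mem_set// mulrAC muE.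
(* Between two states of weight zero [u] is [0] at both ends. The edges used below never lead from
   weight zero to positive weight. *)
have u_edge' b b' : 0 < coupled_rate q b b' -> (m b = 0 -> m b' = 0) -> u b = u b'.
  move=> rbb' mm; have [mb|mb] := eqVneq (m b) 0.
    by rewrite /u (mm mb) mb invr0 !mulr0.
  by apply: u_edge; rewrite mulr_gt0// lt0r mb m0.
have u_const z x x' : u (z, x) = u (z, x').
  apply: label_const.
  - move=> {}z z' {}x zz'; apply: u_edge'; first exact: left_jump_rate.
    move=> /mu_eq0/= muz; rewrite /m /coupled_weight /=.
    have /= -> := mu_right_jump mxi xi_law q_gt0 ((left_jump_right _ _).1 zz').
    by rewrite muz mulr0 mul0r.
  - move=> {}z {}x {}x' xx'; apply: u_edge'; first exact: label_up_rate.
    by move=> /mu_eq0/= muz; rewrite /m /coupled_weight /= muz mul0r.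
case: a => z x.
have C_gt0 := label_partition_gt0 q_gt0 q_lt1 d.
have [muz|muz] := eqVneq (mu z) 0.
  by rewrite m_eq0 /m /coupled_weight /= muz ?mul0r.
(* The common value of [u (z, .)] is found by summing [pi (z, .)] over all labels, which gives
   [mu z]. *)
have uC : u (z, x) * label_partition d q = 1.
  apply: (mulfI muz); rewrite mulr1.
  suff : (mu z * (u (z, x) * label_partition d q))%:E = (mu z)%:E by move=> [].
  rewrite -[RHS]stationary_marginal (eq_esum (b := fun y : Zplus d =>
     ((mu z * u (z, x))%:E * (label_weight q (val y))%:E)%E)); last first.
    by move=> y _; rewrite -EFinM -muE (u_const z y x) /m /coupled_weight /= mulrAC.
  rewrite ge0_esumZl; last 2 first.
  - by rewrite mulr_ge0// divr_ge0.
  - by move=> y; rewrite lee_fin ltW.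
  rewrite (esum_set_typeT (Zplus d) (fun x => (label_weight q x)%:E)).
  by rewrite label_weight_esum// -EFinM mulrA.
rewrite -muE; congr (_ * _); apply: (mulIf (lt0r_neq0 C_gt0)).
by rewrite uC mulVf// gt_eqF.
Qed.

End stationary_coupled.

(** * Telescoping product of the site factors *)

Lemma label_sum z (a : int) (n : nat) : Omega z -> (forall i, i < a -> ~~ z i) ->
  label z (a + n%:Z) = (\sum_(k < n) z (a + k%:Z)%R)%N.
Proof.
move=> Oz za; elim: n => [|n IH].
  rewrite big_ord0 addr0 /label (_ : [set j | _] = set0) ?fset_set0//.
  by apply/seteqP; split=> // j /= [/za/negP].
by rewrite big_ord_recr/= -IH -labelS//; congr (label z _); lia.
Qed.

Section tagged_particles.
Context {R : realType} {d : nat}.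
Variables (q c : R) (m : 'I_d -> int).
Hypothesis q_gt0 : 0 < q.
Hypothesis m_incr : forall i j : 'I_d, (i < j)%N -> m i < m j.

(** Unnormalized probability, given [z], that the second class particles sit at the sites [m]: these
    must be occupied, and the labels are then [label z (m j)]. *)
Definition tag_weight (z : config) : R :=
  \prod_(j < d) ((z (m j))%:R * q ^+ label z (m j)).

(** Contribution of site [i] to [tag_weight]: a particle there is counted by the label of each [m j]
    to its right. *)
Definition tag_factor (i : int) (b : bool) : R :=
  \prod_(j < d) ((if i == m j then b%:R else 1) * q ^+ ((i < m j)%R * b)).

Definition above (i : int) : nat := (\sum_(j < d) (i < m j)%R)%N.

Lemma m_ltE (i j : 'I_d) : (m i < m j) = (i < j)%N.
Proof.
have [ij|ji|/val_inj ->] := ltngtP i j; last by rewrite ltxx.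
- by rewrite m_incr.
- by apply/negbTE; rewrite -leNgt ltW// m_incr.
Qed.

Lemma m_inj : injective m.
Proof.
move=> i j mij; apply/val_inj.
by case: (ltngtP i j) => // /m_incr; rewrite mij ltxx.
Qed.

Lemma tag_factor_ge0 i b : 0 <= tag_factor i b.
Proof.
apply: prodr_ge0 => j _; apply: mulr_ge0; last by rewrite exprn_ge0// ltW.
by case: ifP.
Qed.

Lemma tag_weight_ge0 z : 0 <= tag_weight z.
Proof. by apply: prodr_ge0 => j _; rewrite mulr_ge0// exprn_ge0// ltW. Qed.

Lemma tag_weight_le1 z : q < 1 -> tag_weight z <= 1.
Proof.
move=> q1; apply: prodr_ile1 => j _; have q0 := ltW q_gt0.
have qn0 n : 0 <= q ^+ n by exact: exprn_ge0.
have qn1 n : q ^+ n <= 1 by apply: exprn_ile1 => //; exact: ltW.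
by rewrite mulr_ge0//= mulr_ile1// lern1 leq_b1.
Qed.

Lemma tag_factor_le1 i b : q < 1 -> tag_factor i b <= 1.
Proof.
move=> q1; apply: prodr_ile1 => j _; have q0 := ltW q_gt0.
have b01 : 0 <= (if i == m j then b%:R else 1 : R) <= 1.
  by case: ifP => _; [case: b|]; rewrite ?lexx ler01.
case/andP: b01 => b0 b1.
have qn0 n : 0 <= q ^+ n by exact: exprn_ge0.
have qn1 n : q ^+ n <= 1 by apply: exprn_ile1 => //; exact: ltW.
by rewrite mulr_ge0//= mulr_ile1.
Qed.

(** With no particle to the left of [a], the labels are sums over the sites of the window, so the
    powers of [q] factor over these sites. *)
Lemma tag_weight_local z (a : int) (n : nat) : Omega z ->
  (forall i, i < a -> ~~ z i) -> (forall j, a <= m j < a + n%:Z) ->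
  \prod_(k < n) tag_factor (a + k%:Z) (z (a + k%:Z)) = tag_weight z.
Proof.
move=> Oz za am; rewrite exchange_big; apply: eq_bigr => j _.
rewrite big_split/= prodrXr; have /andP[aj jn] := am j.
have kn : (absz (m j - a)%R < n)%N by lia.
have mjE : m j = a + (absz (m j - a)%R)%:Z by lia.
congr (_ * _ ^+ _).
  rewrite (bigD1 (Ordinal kn))//= -mjE eqxx big1 ?mulr1// => k kne.
  case: eqVneq => // e; case/eqP: kne; apply: val_inj => /=; lia.
rewrite [in RHS]mjE label_sum//.
rewrite (big_ord_widen n (fun k => z (a + k%:Z) : nat)); last exact: ltnW.
rewrite [RHS]big_mkcond/=; apply: eq_bigr => k _.
have -> : (a + k%:Z < m j) = (k < absz (m j - a)%R)%N by lia.
by case: ifP; rewrite ?mul1n.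
Qed.

Notation rho := (mu_density q c).

Definition one_plus_pow (i : int) : R := 1 + q `^ (c - i%:~R).

Notation B := one_plus_pow.

(** With [s = m j - above (m j)]: the numerator stands where an untagged site would give [B s], and
    [B (s - 1)] is the factor skipped in the telescoping; both are restored to the product of the
    [B] and divided out here. *)
Definition tag_density (j : 'I_d) : R :=
  q `^ (c - (m j - (above (m j))%:Z)%:~R) /
  (B (m j - (above (m j))%:Z) * B (m j - (above (m j))%:Z - 1)).

Lemma one_plus_pow_gt0 i : 0 < B i.
Proof. by rewrite addr_gt0// powR_gt0. Qed.

(** Weighting a particle by [q ^ above i] turns [q ^ (c - i)] into [q ^ (c - (i - above i))]. An
    untagged site thus gives a shifted [B], while a tagged site keeps only the term of an occupied
    site. *)
Lemma mean_factorE i :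
  (tag_factor i true * rho i + tag_factor i false * (1 - rho i)) * B i =
  if [exists j, i == m j] then q `^ (c - (i - (above i)%:Z)%:~R)
  else B (i - (above i)%:Z).
Proof.
have -> : tag_factor i true = q ^+ above i.
  rewrite /tag_factor -prodrXr; apply: eq_bigr => j _.
  by rewrite muln1 if_same mul1r.
have -> : tag_factor i false = (~~ [exists j, i == m j])%:R.
  case: existsP => [[j ij]|nj].
    by rewrite /tag_factor (bigD1 j)//= ij !mul0r.
  rewrite /tag_factor big1// => j _; rewrite muln0 expr0 mulr1 ifF//.
  by apply/negP => ij; apply: nj; exists j.
have powE : q `^ (c - (i - (above i)%:Z)%:~R) = q ^+ above i * q `^ (c - i%:~R).
  rewrite -powR_mulrn ?(ltW q_gt0)// -powRD; last by apply/implyP => _; rewrite gt_eqF.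
  by congr (_ `^ _); rewrite intrB; ring.
have B0 := lt0r_neq0 (one_plus_pow_gt0 i).
rewrite mu_densityC// /mu_density -/(B i) mulrDl.
rewrite -mulrA divfK// -mulrA mulVf// mulr1.
by case: existsP => _; rewrite /one_plus_pow powE ?addr0// addrC.
Qed.

Lemma above_pred i :
  (\sum_(j < d) (i <= m j)%R)%N = (above i + [exists j, i == m j])%N.
Proof.
have -> : ([exists j, i == m j] : nat) = (\sum_(j < d) (i == m j))%N.
  case: existsP => [[j ij]|nj].
    rewrite (bigD1 j)//= ij big1// => k kj; move/eqP : ij => ->.
    by rewrite (inj_eq m_inj) eq_sym (negbTE kj).
  by rewrite big1// => j _; case: eqVneq => // ij; case: nj; exists j; rewrite ij.
rewrite /above -big_split/=; apply: eq_bigr => j _.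
by rewrite le_eqVlt; case: ltgtP.
Qed.

Lemma above_succ i : (\sum_(j < d) (i + 1 <= m j)%R)%N = above i.
Proof. by apply: eq_bigr => j _; rewrite lezD1. Qed.

(* [i - above i] runs through the integers as [i] increases, except that it skips
   [m j - above (m j) - 1] when [i] crosses [m j]. *)
Lemma prod_mean_factor (a : int) (n : nat) : (forall j, a <= m j) ->
  \prod_(k < n) ((tag_factor (a + k%:Z) true * rho (a + k%:Z) +
      tag_factor (a + k%:Z) false * (1 - rho (a + k%:Z))) * B (a + k%:Z)) =
  \prod_(j < d | m j < a + n%:Z) tag_density j *
  \prod_(l < n + d - (\sum_(j < d) (a + n%:Z <= m j)%R)) B (a - d%:Z + l%:Z).
Proof.
move=> am; elim: n => [|n IH].
  rewrite big_ord0 addr0 big1 ?mul1r; last first.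
    by move=> j; rewrite ltNge am.
  rewrite (eq_bigr (fun=> 1%N)); last by move=> j _; rewrite am.
  by rewrite sum1_card card_ord subnn big_ord0.
rewrite big_ord_recr/= IH mean_factorE; set i := a + n%:Z.
have iE : i = a + n%:Z by []; clearbody i.
have -> : a + n.+1%:Z = i + 1 by lia.
rewrite above_succ above_pred.
have abd : (above i + [exists j, i == m j] <= d)%N.
  rewrite -above_pred -[leqRHS]card_ord -sum1_card leq_sum// => j _.
  by case: (i <= m j).
case: existsP abd => [[j0 /eqP ij0]|nj] /= abd.
  rewrite [in RHS](bigD1 j0) /=; last by lia.
  rewrite [in RHS](eq_bigl (fun j => m j < i)); last first.
    move=> j; have [->|jj0] := eqVneq j j0; first by rewrite ij0 ltxx /= andbF.
    have : m j != m j0 by rewrite (inj_eq m_inj).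
    by rewrite -ij0 /= andbT; lia.
  (* Crossing a tagged site lengthens the range of the [B] by two, and [tag_density j0] divides out
     both new factors. *)
  have -> : (n.+1 + d - above i = (n + d - (above i + 1)).+2)%N by lia.
  rewrite !big_ord_recr/=.
  have -> : a - d%:Z + (n + d - (above i + 1))%N%:Z = i - (above i)%:Z - 1.
    by lia.
  have -> : a - d%:Z + (n + d - (above i + 1)).+1%N%:Z = i - (above i)%:Z.
    by lia.
  rewrite /tag_density -ij0.
  have B1 := lt0r_neq0 (one_plus_pow_gt0 (i - (above i)%:Z)).
  have B2 := lt0r_neq0 (one_plus_pow_gt0 (i - (above i)%:Z - 1)).
  by field; rewrite B1 B2.
have -> : (n.+1 + d - above i = (n + d - (above i + 0)).+1)%N by lia.
rewrite big_ord_recr/=.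
have -> : a - d%:Z + (n + d - (above i + 0))%N%:Z = i - (above i)%:Z.
  by lia.
rewrite mulrA; congr (_ * _ * _); apply: eq_bigl => j.
have : i != m j by apply/eqP => e; apply: nj; exists j; rewrite e.
lia.
Qed.

(** Beyond all the [m j] the range has [n + d] factors. The last [n] are those of the window and
    cancel; the first [d] lie to the left of [a] and tend to one as [a] goes to minus infinity. *)
Lemma prod_mean_factor_full (a : int) (n : nat) : (forall j, a <= m j < a + n%:Z) ->
  \prod_(k < n) (tag_factor (a + k%:Z) true * rho (a + k%:Z) +
      tag_factor (a + k%:Z) false * (1 - rho (a + k%:Z))) =
  \prod_(j < d) tag_density j * \prod_(l < d) B (a - d%:Z + l%:Z).
Proof.
move=> am; have am1 j : a <= m j by case/andP: (am j).
have am2 j : m j < a + n%:Z by case/andP: (am j).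
have := prod_mean_factor n am1; rewrite big_split/=.
rewrite [\prod_(j < d | _) _](eq_bigl xpredT)//.
have -> : (\sum_(j < d) (a + n%:Z <= m j)%R = 0)%N.
  by rewrite big1// => j _; rewrite leNgt am2.
rewrite subn0.
rewrite addnC big_split_ord/= mulrA.
have -> : \prod_(i < n) B (a - d%:Z + (d + i)%N%:Z) = \prod_(i < n) B (a + i%:Z).
  by apply: eq_bigr => i _; congr B; lia.
apply: mulIf; apply/prodf_neq0 => i _; exact: lt0r_neq0 (one_plus_pow_gt0 _).
Qed.

End tagged_particles.

(** * Mean of the tagged weight *)

Lemma cvg_prod1 (R : realType) (d : nat) (f : nat -> nat -> R) :
  (forall l, f l n @[n --> \oo] --> (1 : R)) ->
  \prod_(l < d) f l n @[n --> \oo] --> (1 : R).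
Proof.
move=> f1; elim: d => [|d IH].
  under [X in X @ _]funext => n do rewrite big_ord0.
  exact: cvg_cst.
under [X in X @ _]funext => n do rewrite big_ord_recr.
by have := cvgM IH (f1 d); rewrite mulr1; apply.
Qed.

Lemma one_plus_pow_cvg1 (R : realType) (q c : R) (a : int) : 0 < q -> q < 1 ->
  one_plus_pow q c (a - n%:Z) @[n --> \oo] --> (1 : R).
Proof.
move=> q0 q1.
have E n : one_plus_pow q c (a - n%:Z) = 1 + q `^ (c - a%:~R) * q ^+ n.
  rewrite /one_plus_pow -powR_mulrn ?(ltW q0)// -powRD; last first.
    by apply/implyP => _; rewrite gt_eqF.
  by congr (_ + _ `^ _); rewrite intrB; ring.
under [X in X @ _]funext => n do rewrite E.
have qn : q ^+ n @[n --> \oo] --> (0 : R) by apply: cvg_expr; rewrite ger0_norm ?ltW.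
have := cvgD (cvg_cst (1 : R)) (cvgM (cvg_cst (q `^ (c - a%:~R))) qn).
by rewrite mulr0 addr0; apply.
Qed.

Section tagged_expectation.
Context {R : realType} {dT : measure_display} {T : measurableType dT}.
Variables (P : probability T R) (q c : R) (xi : T -> Omega) (d : nat) (m : 'I_d -> int).
Hypotheses (q_gt0 : 0 < q) (q_lt1 : q < 1).
Hypothesis m_incr : forall i j : 'I_d, (i < j)%N -> m i < m j.
Hypothesis mxi : forall B : set Omega, measurable (xi @^-1` B).
Hypothesis xi_law : mu_law P q c (fun w => val (xi w)).

Notation mu := (mass P xi).

Let stray (n : nat) (z : Omega) : bool := `[< exists i, i < - n%:Z /\ val z i >].

(** A configuration of [Omega] has a leftmost particle, so these decreasing events have empty
    intersection. *)
Let stray_cvg0 : P [set w | stray n (xi w)] @[n --> \oo] --> 0%E.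
Proof.
pose F n := xi @^-1` [set z | stray n z].
rewrite -(measure0 P) (_ : set0 = \bigcap_n F n); last first.
  apply/esym/seteqP; split=> // w h.
  have [n [zl _]] := Omega_bounded (set_typeP (xi w)).
  have /asboolP[i [/zl/negP]] := h n I.
  by [].
apply: (@nonincreasing_cvg_mu _ _ _ P F).
- by rewrite -ge0_fin_numE// fin_num_measure//; exact: mxi.
- by move=> n; exact: mxi.
- by apply: bigcap_measurable => // n _; exact: mxi.
- move=> n1 n2 n12; apply/subsetPset => w /asboolP[i [ilt zi]].
  apply/asboolP; exists i; split=> //; lia.
Qed.

(* Ignoring the particles to the left of [-n] makes the expectation a finite
   product, at a cost bounded by the probability that there are any. *)
Lemma tag_weight_mean :
  (\esum_(z in [set: Omega]) (mu z * tag_weight q m (val z))%:E =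
   (\prod_(j < d) tag_density q c m j)%:E)%E.
Proof.
have mu0 z : 0 <= mu z by exact: mass_ge0.
(* [M] exceeds every [|m j|], so the window [[-n, M[] contains all the [m j] once [n >= M]. *)
pose M := (\sum_(j < d) absz (m j)).+1%N.
have mM j : (absz (m j) < M)%N by rewrite /M ltnS (bigD1 j)//= leq_addr.
pose G n (z : Omega) : R :=
  \prod_(k < n + M) tag_factor q m (- n%:Z + k%:Z) (val z (- n%:Z + k%:Z)).
have G01 n z : 0 <= G n z <= 1.
  apply/andP; split; first by apply: prodr_ge0 => k _; exact: tag_factor_ge0.
  by apply: prodr_ile1 => k _; rewrite tag_factor_ge0// tag_factor_le1.
have W01 z : 0 <= tag_weight q m (val z) <= 1 by rewrite tag_weight_ge0// tag_weight_le1.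
have GW n z : (M <= n)%N -> ~~ stray n z -> G n z = tag_weight q m (val z).
  move=> Mn ns; apply: (tag_weight_local q_gt0 (set_typeP z)).
  - by move=> i ilt; apply: contraNN ns => zi; apply/asboolP; exists i.
  - by move=> j; have := mM j; lia.
pose E n : R := \prod_(j < d) tag_density q c m j *
  \prod_(l < d) one_plus_pow q c (- n%:Z - d%:Z + l%:Z).
have GE n : (M <= n)%N -> (\esum_(z in [set: Omega]) (mu z * G n z)%:E = (E n)%:E)%E.
  move=> Mn.
  rewrite (mu_product mxi xi_law (- n%:Z)
    (f := fun k : 'I_(n + M) => tag_factor q m (- n%:Z + k%:Z))).
    congr EFin; apply: prod_mean_factor_full => // j; have := mM j; lia.
  by move=> k b; exact: tag_factor_ge0.
have Ecvg : (E n)%:E @[n --> \oo] --> (\prod_(j < d) tag_density q c m j)%:E.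
  apply: cvg_EFin; first by near=> n.
  suff B1 : \prod_(l < d) one_plus_pow q c (- n%:Z - d%:Z + l%:Z) @[n --> \oo] --> (1 : R).
    by have := cvgM (cvg_cst (\prod_(j < d) tag_density q c m j)) B1; rewrite mulr1; apply.
  apply: (@cvg_prod1 _ _ (fun l n => one_plus_pow q c (- n%:Z - d%:Z + l%:Z))) => l.
  have := @one_plus_pow_cvg1 R q c (l%:Z - d%:Z) q_gt0 q_lt1.
  apply: cvg_trans; apply: near_eq_cvg; near=> n.
  by congr one_plus_pow; lia.
(* Used in both directions, with [tag_weight] and its truncation [G n] exchanging roles. *)
have compare (f g : Omega -> R) n : (forall z, 0 <= f z <= 1) ->
    (forall z, 0 <= g z <= 1) -> (forall z, ~~ stray n z -> f z = g z) ->
    (\esum_(z in [set: Omega]) (mu z * f z)%:E <=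
     \esum_(z in [set: Omega]) (mu z * g z)%:E + P [set w | stray n (xi w)])%E.
  move=> f01 g01 fg; rewrite -(mu_event P mxi) -esumD; last 2 first.
  - by move=> z _; rewrite lee_fin mulr_ge0//; case/andP: (g01 z).
  - by move=> z _; rewrite lee_fin mulr_ge0.
  apply: le_esum => z _; rewrite -EFinD lee_fin -mulrDr ler_wpM2l//.
  have /andP[f0 f1] := f01 z; have /andP[g0 g1] := g01 z.
  have [sz|/fg ->] := boolP (stray n z); last by rewrite addr0.
  by rewrite (le_trans f1)// lerDr.
have def0 (x : \bar R) : (x +? 0)%E by exact: fin_num_adde_defl.
apply/eqP; rewrite eq_le; apply/andP; split.
  apply: (cvge_ge (F := \oo) (f := fun n => ((E n)%:E + P [set w | stray n (xi w)])%E)).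
    near=> n; have Mn : (M <= n)%N by near: n; exact: nbhs_infty_ge.
    by rewrite -GE//; apply: compare => // z ns; rewrite GW.
  by have := cvgeD (def0 _) Ecvg stray_cvg0; rewrite adde0; apply.
apply: (@lee_cvg_to _ \oo _ _ (fun n => (E n)%:E) (fun n =>
   \esum_(z in [set: Omega]) (mu z * tag_weight q m (val z))%:E +
   P [set w | stray n (xi w)])%E) => //.
  have := cvgeD (def0 _)
    (cvg_cst (\esum_(z in [set: Omega]) (mu z * tag_weight q m (val z))%:E)%E) stray_cvg0.
  by rewrite adde0; apply.
near=> n; have Mn : (M <= n)%N by near: n; exact: nbhs_infty_ge.
by rewrite -GE//; apply: compare => // z ns; rewrite GW.
Unshelve. all: by end_near. Qed.

End tagged_expectation.

Lemma powR_sum (R : realType) (q : R) (d : nat) (f : 'I_d -> R) : 0 < q ->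
  \prod_(j < d) q `^ f j = q `^ (\sum_(j < d) f j).
Proof.
move=> q0; rewrite (big_morph (powR q) (id1 := 1) (op1 := *%R)) ?powRr0// => x y.
by rewrite powRD//; apply/implyP => _; rewrite gt_eqF.
Qed.

Lemma sum_ltn_ord (d : nat) (i : nat) : (\sum_(l < d) (i < l))%N = (d - i.+1)%N.
Proof.
elim: d => [|d IH]; first by rewrite big_ord0.
by rewrite big_ord_recr/= IH; case: ltnP; lia.
Qed.

Lemma above_tag (d : nat) (m : 'I_d -> int) (j : 'I_d) :
  (forall i j : 'I_d, (i < j)%N -> m i < m j) -> above m (m j) = (d - j.+1)%N.
Proof.
move=> m_incr; rewrite -sum_ltn_ord /above.
by apply: eq_bigr => l _; rewrite m_ltE.
Qed.

(** The shifts [above (m j) = d - 1 - j] add up to [d choose 2]; the resulting power of [q] is the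
    one in the numerator of [label_partition]. *)
Lemma prod_tag_density (R : realType) (q c : R) (d : nat) (m : 'I_d -> int) :
  0 < q -> (forall i j : 'I_d, (i < j)%N -> m i < m j) ->
  \prod_(j < d) tag_density q c m j =
  q ^+ 'C(d, 2) * (q `^ (d%:R * c - \sum_(j < d) (m j)%:~R) /
   \prod_(j < d)
     ((1 + q `^ (c + d%:R - j.+1%:R - (m j)%:~R)) *
      (1 + q `^ (c + d%:R + 1 - j.+1%:R - (m j)%:~R)))).
Proof.
move=> q0 m_incr; rewrite prodf_div mulrA; congr (_ / _).
  rewrite powR_sum// -powR_mulrn ?ltW// -powRD; last first.
    by apply/implyP => _; rewrite gt_eqF.
  congr (_ `^ _); rewrite (eq_bigr (fun j => (c - (m j)%:~R) + (d - j.+1)%:R)).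
    rewrite big_split/= sumrB sumr_const card_ord mulr_natl addrC; congr (_ + _).
    rewrite -natr_sum -bin2_sum big_mkord.
    by rewrite [in RHS](reindex_inj rev_ord_inj).
  by move=> j _; rewrite above_tag// intrB opprB addrA addrAC.
apply: eq_bigr => j _; have jd : (j < d)%N by [].
rewrite /one_plus_pow above_tag//.
have kE : (d - j.+1)%N%:~R = d%:R - j.+1%:R :> R by rewrite -natrB.
congr ((_ + _ `^ _) * (_ + _ `^ _)); rewrite ?intrB kE; ring.
Qed.

(* Coordinates are indexed from 0, whence the [j.+1] in the exponents. *)
Theorem theorem1p8 (R : realType) (q c : R) (d : nat)
    (dT : measure_display) (T : measurableType dT) (P : probability T R)
    (Z : R -> T -> coupled_state d)
    (q_gt0 : 0 < q) (q_lt1 : q < 1) (d_ge1 : (1 <= d)%N)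
    (Z_process : markov_jump_process P (coupled_rate q) Z)
    (Z_stationary : stationary P Z)
    (xi_law : mu_law P q c (fun w => val (Z 0 w).1))
    (t : R) (t_ge0 : 0 <= t)
    (m : 'I_d -> int) (m_incr : forall i j : 'I_d, (i < j)%N -> m i < m j) :
  P [set w | forall j : 'I_d, second_class_position (Z t w) j = m j] =
  (((\prod_(i < d) (1 - q ^+ i.+1)) *
    q `^ (d%:R * c - \sum_(j < d) (m j)%:~R)) /
   \prod_(j < d)
     ((1 + q `^ (c + d%:R - j.+1%:R - (m j)%:~R)) *
      (1 + q `^ (c + d%:R + 1 - j.+1%:R - (m j)%:~R))))%:E.
Proof.
have q_ge0 := ltW q_gt0.
have mZ (B : set (coupled_state d)) : measurable (Z 0 @^-1` B).
  by case: Z_process => mZ _ _; exact: mZ.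
pose xi w := (Z 0 w).1.
have mxi (B : set Omega) : measurable (xi @^-1` B) by exact: (mZ [set a | B a.1]).
set C := label_partition d q.
have C_gt0 : 0 < C by exact: label_partition_gt0.
pose A := [set a : coupled_state d | forall j, second_class_position a j = m j].
pose mu := mass P xi.
have mu0 z : 0 <= mu z by exact: mass_ge0.
(* Given [z], a single label vector puts the second class particles at [m], namely
   [x j = label z (m j)], and only if all these sites are occupied; the sum over [x] reduces to that
   term. *)
have row (z : Omega) : (\esum_(x in [set: Zplus d])
      (if (z, x) \in A then (mass P (Z 0) (z, x))%:E else 0) =
    (C^-1)%:E * (mu z * tag_weight q m (val z))%:E)%E.
  have Oz := set_typeP z.
  have inA x : (z, x) \in A <-> forall j, val z (m j) /\ label (val z) (m j) = val x j.
    by split; rewrite inE => zx j; apply/siteP => //; exact: zx.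
  case: (boolP [forall j, val z (m j)]) => [/forallP zm|].
    have Zx : Zplus d [ffun j => label (val z) (m j)].
      by move=> i j ij; rewrite !ffunE label_lt ?m_incr.
    rewrite -(@esum_mkpoint _ _ (to_set_type Zx)
      (fun=> ((C^-1)%:E * (mu z * tag_weight q m (val z))%:E)%E)).
      apply: eq_esum => x _; case: eqVneq => [->|xne].
        rewrite (inA _).2 => [|j]; last first.
          by split; [exact: zm|rewrite /= ffunE].
        rewrite (stationary_product q_gt0 q_lt1 Z_process Z_stationary xi_law).
        rewrite -EFinM mulrC; congr ((_ * (_ * _))%:E).
        rewrite /label_weight /= -prodrXr; apply: eq_bigr => j _.
        by rewrite zm mul1r ffunE.
      case: ifP => // /(inA _).1 zx; case/eqP: xne; apply: val_inj.
      by apply/ffunP => j; rewrite /= ffunE; have [_ ->] := zx j.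
    by rewrite -EFinM lee_fin !mulr_ge0 ?invr_ge0 ?(ltW C_gt0) ?tag_weight_ge0.
  rewrite negb_forall => /existsP[j zj].
  rewrite esum1 => [|x _]; last first.
    by rewrite ifF//; apply/negP => /(inA _).1 /(_ j)[zmj]; rewrite zmj in zj.
  by rewrite /tag_weight (bigD1 j)//= (negbTE zj) !mul0r mulr0 mule0.
have -> : [set w | forall j, second_class_position (Z t w) j = m j] = Z t @^-1` A by [].
rewrite Z_stationary// (law_esum P mZ (countable_coupled_state d)).
rewrite [LHS]esum_mkcond esum_pair; last first.
  by move=> a; case: ifP => // _; rewrite lee_fin mass_ge0.
rewrite (eq_esum (fun z _ => row z)) ge0_esumZl ?invr_ge0 ?(ltW C_gt0)//; last first.
  by move=> z; rewrite lee_fin mulr_ge0// tag_weight_ge0.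
rewrite (tag_weight_mean q_gt0 q_lt1 m_incr mxi xi_law) prod_tag_density//.
rewrite -EFinM /C /label_partition invfM invrK; congr EFin.
have qC : q ^+ 'C(d, 2) != 0 by rewrite expf_neq0// gt_eqF.
by rewrite !mulrA; congr (_ * _ / _); rewrite mulrAC mulVf// mul1r.
Qed.
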